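(* Let $F$ be an arbitrary cdf on $\mathbb{R}$ with finite expectation and let $\theta\in\Theta$. Let $L''_\theta(\mathbf{F}^{-1})$ denote the class of all functions $T:\mathbb{R}\to\mathbb{R}$ which are a.e. differentiable on $\mathbb{R}$ and satisfy $$\int_{\mathbb{R}}K(F(x))\frac{dT}{d\lambda}(x)\,\lambda(dx)=f(\theta),$$ and let $L_\theta(\mathbf{F}^{-1})$ denote the set of $\sigma$-finite signed measures $\mathbf{G}^{-1}$ on $(0,1)$ such that $\mathbf{G}^{-1}\ll\mathbf{F}^{-1}$ and $\int_0^1K(u)\,\mathbf{G}^{-1}(du)=f(\theta)$. If there exist $T\in L''_\theta(\mathbf{F}^{-1})$ such that $a_\varphi<\frac{dT}{d\lambda}<b_\varphi$ ($\lambda$-a.e.) and $\mathbf{G}^{-1}\in L_\theta(\mathbf{F}^{-1})$ such that $a_\varphi<\frac{d\mathbf{G}^{-1}}{d\mathbf{F}^{-1}}<b_\varphi$ ($\mathbf{F}^{-1}$-a.e.), then $$\inf_{\mathbf{G}^{-1}\in L_\theta(\mathbf{F}^{-1})}\int_0^1\varphi\left(\frac{d\mathbf{G}^{-1}}{d\mathbf{F}^{-1}}(u)\right)\mathbf{F}^{-1}(du)=\inf_{T\in L''_\theta(\mathbf{F}^{-1})}\int_{\mathbb{R}}\varphi\left(\frac{dT}{d\lambda}\right)d\lambda.$$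
   Context: $\lambda$ is Lebesgue measure on $\mathbb{R}$. $\varphi:\mathbb{R}\to[0,+\infty]$ is a strictly convex function with $\varphi(1)=0$ and $\{x:\varphi(x)<\infty\}=(a_\varphi,b_\varphi)$, $a_\varphi<1<b_\varphi$. For a cdf $F$, $F^{-1}(u)=\inf\{x:F(x)\ge u\}$, $u\in(0,1)$, and $\mathbf{F}^{-1}$ is the quantile measure: the positive $\sigma$-finite measure on $(0,1)$ with $\mathbf{F}^{-1}([s,t))=F^{-1}(t)-F^{-1}(s)$ for $0<s\le t<1$. The notation $\mathbf{G}^{-1}$ for an element of $L_\theta(\mathbf{F}^{-1})$ does not require it to be a quantile measure. With the shifted Legendre polynomials $L_r(t)=\sum_{k=0}^r(-1)^k\binom rk^2t^{r-k}(1-t)^k$, put $K_r(t)=\int_0^tL_{r-1}(u)\,du$ for $r\ge1$; fix integers $2\le i_1<\dots<i_l$ and let $K=(K_{i_1},\dots,K_{i_l})^T:[0,1]\to\mathbb{R}^l$. $\Theta\subset\mathbb{R}^d$ and $f:\Theta\to\mathbb{R}^l$ are given. *)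

(* Defs.v *)
From HB Require Import structures.
From mathcomp Require Export all_boot all_order all_algebra.
From mathcomp Require Export all_classical all_reals all_analysis.
Export numFieldNormedType.Exports.

Set Implicit Arguments.
Unset Strict Implicit.
Unset Printing Implicit Defensive.
Import Order.TTheory GRing.Theory Num.Theory.

Local Open Scope classical_set_scope.
Local Open Scope ring_scope.

(* The library's charges are finite, hence this separate development: a signed
   measure may take at most one of the values +oo and -oo. Only the
   values on measurable sets are meaningful. *)
Section signed_measures.
Context d (T : measurableType d) (R : realType).
Local Open Scope ereal_scope.
Implicit Types (G : set T -> \bar R) (h : T -> R).

Definition signed_measure G :=
  [/\ G set0 = 0,
      (forall A, measurable A -> G A != -oo) \/
      (forall A, measurable A -> G A != +oo) &
      semi_sigma_additive G].

(* The library's sigma_finite only bounds values from above, which is not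
   enough for a signed measure. *)
Definition sigma_finite_signed (D : set T) G :=
  exists2 A : (set T)^nat, D = \bigcup_n A n &
    forall n, measurable (A n) /\ G (A n) \is a fin_num.

(* A measure on D is represented by a measure on T that vanishes off D. *)
Definition sigma_finite_signed_measure_on (D : set T) G :=
  [/\ signed_measure G,
      (forall A, measurable A -> A `<=` ~` D -> G A = 0) &
      sigma_finite_signed D G].

(* the positive and negative parts of the Jordan decomposition *)
Definition positive_variation G (A : set T) : \bar R :=
  ereal_sup [set G B | B in [set B | measurable B /\ B `<=` A]].

Definition negative_variation G (A : set T) : \bar R :=
  ereal_sup [set - G B | B in [set B | measurable B /\ B `<=` A]].

Definition signed_integrable G (D : set T) h :=
  (positive_variation G).-integrable D (EFin \o h) /\
  (negative_variation G).-integrable D (EFin \o h).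

Definition signed_integral G (D : set T) h : R :=
  fine (\int[positive_variation G]_(x in D) (h x)%:E) -
  fine (\int[negative_variation G]_(x in D) (h x)%:E).

Definition is_density G (Q : set T -> \bar R) (g : T -> R) :=
  measurable_fun setT g /\
  forall A, measurable A -> G A = \int[Q]_(x in A) (g x)%:E.

(* a version of dG/dQ; a dummy value if there is none *)
Definition density G (Q : set T -> \bar R) : T -> R :=
  xget (cst 0%R) [set g | is_density G Q g].

End signed_measures.

Section strict_convexity.
Context (R : realType).
Local Open Scope ereal_scope.

(* Outside the effective domain the convexity inequality is trivial. *)
Definition strictly_convex (phi : R -> \bar R) :=
  forall x y t : R, x != y -> phi x < +oo -> phi y < +oo -> (0 < t < 1)%R ->
    phi (t * x + (1 - t) * y)%R < t%:E * phi x + (1 - t)%:E * phi y.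

End strict_convexity.

(* Typed so that its sigma-algebra is the one that carries lebesgue_measure. *)
Definition open01 (R : realType) : set (measurableTypeR R) :=
  [set u : R | 0 < u < 1].
Arguments open01 : clear implicits.

Section quantiles_and_Lmoments.
Context (R : realType).

Definition quantile (F : R -> R) (u : R) : R := inf [set x | u <= F x].

Definition quantile_measure (F : R -> R)
    (Q : set (measurableTypeR R) -> \bar R) :=
  Q (~` open01 R) = 0%E /\
  forall s t : R, 0 < s -> s <= t -> t < 1 ->
    Q `[s, t[%classic = (quantile F t - quantile F s)%:E.

Definition shifted_legendre (r : nat) (t : R) : R :=
  \sum_(k < r.+1) (-1) ^+ k * 'C(r, k)%:R ^+ 2 * t ^+ (r - k) * (1 - t) ^+ k.

Definition Kfun (r : nat) (t : R) : R :=
  \int[lebesgue_measure]_(u in `[0, t]) shifted_legendre r.-1 u.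

(* L_theta(F^-1), where Q is the quantile measure of F and c is f(theta) *)
Definition L_class (l : nat) (i : 'I_l -> nat)
    (Q : set (measurableTypeR R) -> \bar R) (c : 'cV[R]_l) :
    set (set (measurableTypeR R) -> \bar R) :=
  [set G : set (measurableTypeR R) -> \bar R |
     [/\ sigma_finite_signed_measure_on (open01 R) G,
         G `<< Q,
         forall j, signed_integrable G (open01 R) (Kfun (i j)) &
         \col_j signed_integral G (open01 R) (Kfun (i j)) = c]].

(* L''_theta(F^-1), where c is f(theta). As T is arbitrary, its derivative is
   in general only Lebesgue (not Borel) measurable: integrals are taken with
   respect to the completed Lebesgue measure. *)
Definition L''_class (l : nat) (i : 'I_l -> nat) (F : R -> R) (c : 'cV[R]_l) :
    set (R -> R) :=
  [set T | [/\ {ae completed_lebesgue_measure, forall x : R, derivable T x 1},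
               forall j, completed_lebesgue_measure.-integrable setT
                 (fun x : R => (Kfun (i j) (F x) * derive1 T x)%:E) &
               \col_j \int[completed_lebesgue_measure]_x
                 (Kfun (i j) (F x) * derive1 T x) = c]].

End quantiles_and_Lmoments.

(* Main.v *)
(** Let [D] be the set of [x] with [0 < F x < 1]. The quantile measure [Q] is the
  image under [F] of Lebesgue measure on [D], and [K (F x) = 0] off [D] because
  [K_r] vanishes at [0] and [1] for [r >= 2].

  From [G] with density [g], one takes [T] with [T' = g \o F] on [D] and
  [T' = 1] off [D]; both constraints and both divergences agree. Such a [T]
  exists because a strictly convex [phi >= 0] with [phi 1 = 0] grows at least
  linearly at infinity, so that a finite divergence forces local integrability.

  From [T], one takes for [G] the image under [F] of the signed measure with
  Lebesgue density [T'] on [D]. The negative part of [T'] is integrable, again by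
  linear growth, so that [G] is a signed measure. Its density [g] is the
  conditional expectation of [T'] given [F], and Jensen's inequality shows that
  the divergence does not increase.

  When a divergence is infinite there is nothing to compare. *)

From HB Require Import structures.
Require Import Defs.
From mathcomp Require Import measurable_realfun ring lra.

Set Implicit Arguments.
Unset Strict Implicit.
Unset Printing Implicit Defensive.
Import Order.TTheory GRing.Theory Num.Theory.
Local Open Scope classical_set_scope.
Local Open Scope ring_scope.

(** * Measures with densities *)

(** Lebesgue measure on [D] and [Q] may both be infinite, so neither conditional expectation nor
    Jensen's inequality is available in its probabilistic form. Everything is localised on the
    intervals [[1/(n+2), 1 - 1/(n+2))]: since [quantile F u <= x] is equivalent to [u <= F x], their
    preimages under [F] are bounded intervals, of finite Lebesgue measure. This makes the image of
    [T'] sigma-finite, so that it has a Radon-Nikodym density. Jensen's inequality is then proved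
    from supporting lines, which first requires that the conditional expectation stay almost
    everywhere in the open domain of [phi]. Another obstacle is that [T] is arbitrary: [T'] is
    replaced by a Borel function that agrees with it wherever [T] is differentiable. The negative
    part of [T'] is integrable over a set of possibly infinite measure because 1 is positive: a
    supporting line at a point of [[0, 1)] bounds [-z] by a multiple of [phi z] without additive
    constant. *)

Section weighted_pushforward.
Local Open Scope ereal_scope.
Context d1 d2 (T1 : measurableType d1) (T2 : measurableType d2) (R : realType).
Variables (mu : {measure set T1 -> \bar R}) (nu : {measure set T2 -> \bar R}).
Variables (p : T1 -> T2) (E : set T1) (f : T1 -> R).
Hypotheses (mp : measurable_fun setT p) (mE : measurable E).
Hypotheses (mf : measurable_fun setT f) (f0 : forall x, (0 <= f x)%R).
Hypothesis nuE : forall A, measurable A ->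
  nu A = \int[mu]_(x in p @^-1` A `&` E) (f x)%:E.

Import HBNNSimple.

(** Three changes of measure are instances: [p = id] for a measure with a density, [p = F] with
    weight 1 for the quantile measure, and [p = F] with a part of [T'] as weight for the conditional
    expectation. *)
Lemma integral_weighted_pushforward (D : set T2) (k : T2 -> \bar R) :
  measurable D -> measurable_fun D k -> (forall y, D y -> 0 <= k y) ->
  \int[nu]_(y in D) k y =
  \int[mu]_(x in p @^-1` D `&` E) (k (p x) * (f x)%:E).
Proof.
move=> mD mk k0.
have mpre A : measurable A -> measurable (p @^-1` A).
  by move=> mA; rewrite -(setTI (p @^-1` A)); exact: mp.
have mDE : measurable (p @^-1` D `&` E) by apply: measurableI => //; exact: mpre.
have mfE B : measurable_fun B (EFin \o f).
  by apply: measurable_funTS; exact/measurable_EFinP.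
pose h := nnsfun_approx mD mk.
have mh n : measurable_fun setT (EFin \o h n \o p).
  by do 2 apply: measurableT_comp => //.
have -> : \int[nu]_(y in D) k y =
    lim (\int[nu]_(y in D) (EFin \o h n) y @[n --> \oo]).
  have kE x : D x -> k x = lim ((EFin \o h n) x @[n --> \oo]).
    by move=> Dx; apply/esym/cvg_lim => //; exact: cvg_nnsfun_approx.
  under eq_integral => x /[!inE] /kE -> //.
  apply: monotone_convergence => //.
  - by move=> n; apply/measurable_EFinP; exact: measurable_funTS.
  - by move=> n x Dx //=; rewrite lee_fin.
  - by move=> x Dx a b ab; rewrite lee_fin; exact/lefP/nd_nnsfun_approx.
have -> : \int[mu]_(x in p @^-1` D `&` E) (k (p x) * (f x)%:E) =
    lim (\int[mu]_(x in p @^-1` D `&` E) ((h n (p x))%:E * (f x)%:E)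
      @[n --> \oo]).
  have fg x : (p @^-1` D `&` E) x ->
      k (p x) * (f x)%:E = lim ((h n (p x))%:E * (f x)%:E @[n --> \oo]).
    move=> [Dx _]; apply/esym/cvg_lim => //; apply: cvgeZr => //.
    exact: (cvg_nnsfun_approx mD mk).
  under eq_integral => x /[!inE] /fg -> //.
  apply: monotone_convergence => [//| | |].
  - move=> n; apply/emeasurable_funM => //; exact/measurable_funTS/mh.
  - by move=> n x Ex /=; rewrite mule_ge0 ?lee_fin ?f0.
  - move=> x Ex a b ab/=; rewrite lee_wpmul2r ?lee_fin ?f0//.
    exact/lefP/nd_nnsfun_approx.
(* What remains is the simple function [h n], treated value by value: each indicator is integrated
   by [nuE]. *)
congr (lim (_ @ \oo)); apply/funext => n.
have indich r : measurable_fun D (fun x => (r * \1_(h n @^-1` [set r]) x)%:E).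
  by apply: (measurable_comp measurableT) => //; exact: measurable_funM.
transitivity (\int[nu]_(x in D)
   (\sum_(y \in range (h n)) (y * \1_(h n @^-1` [set y]) x)%:E)).
  by apply: eq_integral => t tE; rewrite /= fimfunE -fsumEFin.
rewrite ge0_integral_fsum//; last by move=> m y Ey; exact: nnfun_muleindic_ge0.
transitivity (\int[mu]_(x in p @^-1` D `&` E) (\sum_(y \in range (h n))
    (y * \1_(h n @^-1` [set y]) (p x))%:E * (f x)%:E)); last first.
  apply: eq_integral => x xE.
  rewrite -ge0_mule_fsuml => [|y]; last exact: nnfun_muleindic_ge0.
  by rewrite fsumEFin // -(fimfunE _ (p x)).
have mind (r : R) : measurable_fun setT
    (fun x => (\1_(h n @^-1` [set r]) (p x) : R)%:E).
  apply/measurable_EFinP.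
  by apply: (@measurableT_comp _ _ _ _ _ _
    (\1_(h n @^-1` [set r]) : T2 -> R)) => //; exact: measurable_indic.
rewrite ge0_integral_fsum//; last 2 first.
  - move=> y; apply: emeasurable_funM => //; apply: measurable_funTS.
    by under eq_fun do rewrite EFinM; exact: emeasurable_funM.
  - by move=> m y Ey; rewrite mule_ge0 ?lee_fin ?f0// -lee_fin nnfun_muleindic_ge0.
apply: eq_fsbigr => r rhn.
under eq_integral do rewrite EFinM.
rewrite integralZl_indic_nnsfun => //.
under [RHS]eq_integral do rewrite EFinM -muleA.
rewrite ge0_integralZl//; last 3 first.
- apply: emeasurable_funM => //; exact/measurable_funTS/mind.
- by move=> t Et; rewrite mule_ge0 ?lee_fin ?f0.
- by move: rhn; rewrite inE => -[t _ <-]; rewrite lee_fin.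
congr (_ * _).
rewrite integral_indic// nuE; last exact: measurableI.
rewrite [RHS](eq_integral
  ((EFin \o f) \_ (p @^-1` (h n @^-1` [set r])))); last first.
  move=> x xE; rewrite patchE indicE -[p x \in _]/(x \in p @^-1` _).
  by case: ifPn => _ /=; rewrite ?mul1e ?mul0e.
by rewrite -integral_mkcondr; congr integral; apply/seteqP; split => x /=; tauto.
Qed.

End weighted_pushforward.

Section weighted_pushforward_measure.
Local Open Scope ereal_scope.
Context d1 d2 (T1 : measurableType d1) (T2 : measurableType d2) (R : realType).
Variables (mu : {measure set T1 -> \bar R}) (p : T1 -> T2) (E : set T1).
Variable f : T1 -> R.
Hypotheses (mp : measurable_fun setT p) (mE : measurable E).
Hypotheses (mf : measurable_fun setT f) (f0 : forall x, (0 <= f x)%R).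

(** The variations in [signed_integral] are bare set functions. An equality of functions, not merely
    of values on measurable sets, lets results on measures be rewritten into integrals against them;
    the integral formula itself is only asked on measurable sets, where the variations satisfy
    it. *)
Lemma weighted_pushforward_measure (nu : set T2 -> \bar R) :
  (forall A, 0 <= nu A) ->
  (forall A, measurable A -> nu A = \int[mu]_(x in p @^-1` A `&` E) (f x)%:E) ->
  {m : {measure set T2 -> \bar R} | m = nu :> (set T2 -> \bar R)}.
Proof.
move=> nu0 nuE.
have mpre A : measurable A -> measurable (p @^-1` A `&` E).
  by move=> mA; apply: measurableI => //; rewrite -(setTI (p @^-1` A)); exact: mp.
have nuset0 : nu set0 = 0 by rewrite nuE// preimage_set0 set0I integral_set0.
have nusigma : semi_sigma_additive nu.
  move=> F mF tF mUF.
  have /= := @semi_sigma_additive_nng_induced _ _ _ mu (EFin \o f) _ _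
    (fun n => p @^-1` (F n) `&` E).
  rewrite nuE// preimage_bigcup setI_bigcupl.
  under [X in _ -> X @ _ --> _]eq_fun do under eq_bigr do rewrite nuE//.
  apply => //.
  - exact/measurable_EFinP.
  - by move=> n; exact: mpre.
  - apply/trivIsetP => i j _ _ ij; move/trivIsetP : tF => /(_ i j I I ij) Fij.
    by rewrite setIACA setIid -preimage_setI Fij preimage_set0 set0I.
  - by rewrite -setI_bigcupl -preimage_bigcup; exact: mpre.
pose numixin := isMeasure.Build _ _ _ nu nuset0 nu0 nusigma.
pose m : {measure set T2 -> \bar R} := HB.pack nu numixin.
by exists m.
Qed.

End weighted_pushforward_measure.

(** * Jordan decomposition of a signed measure with a density *)

Section signed_densities.
Local Open Scope ereal_scope.
Context d (T : measurableType d) (R : realType).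
Variables (Q : {measure set T -> \bar R}) (G : set T -> \bar R) (g : T -> R).
Hypothesis gG : is_density G Q g.

Let mg : measurable_fun setT g. Proof. by case: gG. Qed.
Let mgp : measurable_fun setT g^\+%R. Proof. exact: measurable_funrpos. Qed.
Let mgn : measurable_fun setT g^\-%R. Proof. exact: measurable_funrneg. Qed.

Let GE A : measurable A -> G A = \int[Q]_(x in A) (g^\+ x)%:E
  - \int[Q]_(x in A) (g^\- x)%:E.
Proof.
by case: gG => _ h mA; rewrite h// integralE -[(fun x => (g x)%:E)]/(EFin \o g)
  funerpos funerneg.
Qed.

Let gDE x : (g^\+ x + g^\- x = `|g x|)%R.
Proof. exact: (congr1 (fun h => h x) (funrposDneg g)). Qed.

Let gBE x : (g^\+ x - g^\- x = g x)%R.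
Proof. exact: (congr1 (fun h => h x) (funrposBneg g)). Qed.

Let pos_ge0 A : 0 <= \int[Q]_(x in A) (g^\+ x)%:E.
Proof. by apply: integral_ge0 => x _; rewrite lee_fin funrpos_ge0. Qed.

Let neg_ge0 A : 0 <= \int[Q]_(x in A) (g^\- x)%:E.
Proof. by apply: integral_ge0 => x _; rewrite lee_fin funrneg_ge0. Qed.

Lemma density0 : G set0 = 0.
Proof. by rewrite GE// !integral_set0 sube0. Qed.

Lemma positive_variation_ge0 A : 0 <= positive_variation G A.
Proof.
apply: ereal_sup_ubound => /=; exists set0; last exact: density0.
by split => //; exact: sub0set.
Qed.

Lemma negative_variation_ge0 A : 0 <= negative_variation G A.
Proof.
apply: ereal_sup_ubound => /=; exists set0; last by rewrite density0 oppe0.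
by split => //; exact: sub0set.
Qed.

(** The supremum is attained at the part of [A] where [g] is nonnegative: the sign of the density
    yields a Hahn decomposition. *)
Lemma positive_variationE A : measurable A ->
  positive_variation G A = \int[Q]_(x in A) (g^\+ x)%:E.
Proof.
move=> mA; apply/eqP; rewrite eq_le; apply/andP; split.
  apply: ge_ereal_sup => _ [B [mB BA] <-]; rewrite GE//.
  apply: (@le_trans _ _ (\int[Q]_(x in B) (g^\+ x)%:E)).
    by rewrite geeDl// oppe_le0.
  apply: ge0_subset_integral => //.
    exact/measurable_EFinP/measurable_funTS.
  by move=> x _; rewrite lee_fin funrpos_ge0.
have mP : measurable [set x | (0 <= g x)%R].
  by rewrite -[X in measurable X]setTI; exact: measurable_fun_le.
have mAP : measurable (A `&` [set x | (0 <= g x)%R]) by exact: measurableI.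
apply: ereal_sup_ubound => /=; exists (A `&` [set x | (0 <= g x)%R]).
  by split => //; exact: subIsetl.
rewrite GE// [X in _ - X]integral0_eq; last first.
  by move=> x [_ /= gx]; rewrite /funrneg max_r ?oppr_le0.
rewrite sube0 integral_mkcondr; apply: eq_integral => x _; rewrite patchE.
case: ifPn => //; rewrite notin_setE /= => /negP; rewrite -ltNge => gx.
by rewrite /funrpos max_r// ltW.
Qed.

Lemma negative_variationE A : measurable A ->
  negative_variation G A = \int[Q]_(x in A) (g^\- x)%:E.
Proof.
move=> mA; apply/eqP; rewrite eq_le; apply/andP; split.
  apply: ge_ereal_sup => _ [B [mB BA] <-]; rewrite GE//.
  apply: (@le_trans _ _ (\int[Q]_(x in B) (g^\- x)%:E)).
    (* Both integrals may be infinite; [+oo - +oo] is then [-oo], whose opposite still does not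
       exceed the second integral. *)
    move: (pos_ge0 B) (neg_ge0 B).
    case: (\int[Q]_(x in B) (g^\+ x)%:E) => [r| |]//;
    case: (\int[Q]_(x in B) (g^\- x)%:E) => [s| |]//=;
      rewrite ?leNye ?leey//.
    by rewrite !lee_fin => r0 s0; rewrite opprB lerBlDr lerDl.
  apply: ge0_subset_integral => //.
    exact/measurable_EFinP/measurable_funTS.
  by move=> x _; rewrite lee_fin funrneg_ge0.
have mP : measurable [set x | (g x <= 0)%R].
  by rewrite -[X in measurable X]setTI; exact: measurable_fun_le.
have mAP : measurable (A `&` [set x | (g x <= 0)%R]) by exact: measurableI.
apply: ereal_sup_ubound => /=; exists (A `&` [set x | (g x <= 0)%R]).
  by split => //; exact: subIsetl.
rewrite GE// [X in X - _]integral0_eq; last first.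
  by move=> x [_ /= gx]; rewrite /funrpos max_r.
rewrite sub0e oppeK integral_mkcondr; apply: eq_integral => x _; rewrite patchE.
case: ifPn => //; rewrite notin_setE /= => /negP; rewrite -ltNge => gx.
by rewrite /funrneg max_r// oppr_le0 ltW.
Qed.

Let weightE (f : T -> R) (nu : set T -> \bar R) :
  (forall A, measurable A -> nu A = \int[Q]_(x in A) (f x)%:E) ->
  forall A, measurable A -> nu A = \int[Q]_(x in id @^-1` A `&` setT) (f x)%:E.
Proof. by move=> h A mA; rewrite setIT h. Qed.

Lemma positive_variation_measure :
  {m : {measure set T -> \bar R} | m = positive_variation G :> (set T -> \bar R)}.
Proof.
exact: (weighted_pushforward_measure (@measurable_id _ T setT) measurableT
  mgp (funrpos_ge0 g) positive_variation_ge0 (weightE positive_variationE)).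
Qed.

Lemma integral_positive_variation (X : set T) (k : T -> \bar R) :
  measurable X -> measurable_fun X k -> (forall x, X x -> 0 <= k x) ->
  \int[positive_variation G]_(x in X) k x =
  \int[Q]_(x in X) (k x * (g^\+ x)%:E).
Proof.
move=> mX mk k0.
have mid : measurable_fun setT (@id T) by exact: measurable_id.
have [m mE] := positive_variation_measure.
have mQ A : measurable A -> m A = \int[Q]_(x in id @^-1` A `&` setT) (g^\+ x)%:E.
  by rewrite mE; exact: (weightE positive_variationE).
rewrite -mE (integral_weighted_pushforward mid measurableT mgp (funrpos_ge0 g) mQ)//.
by rewrite setIT.
Qed.

Lemma negative_variation_measure :
  {m : {measure set T -> \bar R} | m = negative_variation G :> (set T -> \bar R)}.
Proof.
exact: (weighted_pushforward_measure (@measurable_id _ T setT) measurableT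
  mgn (funrneg_ge0 g) negative_variation_ge0 (weightE negative_variationE)).
Qed.

Lemma integral_negative_variation (X : set T) (k : T -> \bar R) :
  measurable X -> measurable_fun X k -> (forall x, X x -> 0 <= k x) ->
  \int[negative_variation G]_(x in X) k x =
  \int[Q]_(x in X) (k x * (g^\- x)%:E).
Proof.
move=> mX mk k0.
have mid : measurable_fun setT (@id T) by exact: measurable_id.
have [m mE] := negative_variation_measure.
have mQ A : measurable A -> m A = \int[Q]_(x in id @^-1` A `&` setT) (g^\- x)%:E.
  by rewrite mE; exact: (weightE negative_variationE).
rewrite -mE (integral_weighted_pushforward mid measurableT mgn (funrneg_ge0 g) mQ)//.
by rewrite setIT.
Qed.

Let split_abs (X : set T) (k : T -> R) : measurable X -> measurable_fun X k ->
  \int[Q]_(x in X) `|(k x * g x)%:E| =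
  \int[Q]_(x in X) (`|(k x)%:E| * (g^\+ x)%:E) +
  \int[Q]_(x in X) (`|(k x)%:E| * (g^\- x)%:E).
Proof.
move=> mX mk.
have mak : measurable_fun X (fun x => `|(k x)%:E|).
  by apply: measurableT_comp => //; exact/measurable_EFinP.
rewrite -ge0_integralD//.
- apply: eq_integral => x _; rewrite -ge0_muleDr ?lee_fin ?funrpos_ge0//.
    by rewrite -EFinD gDE EFinM abseM.
- by move=> x _; rewrite mule_ge0// lee_fin funrpos_ge0.
- by apply: emeasurable_funM => //; exact/measurable_funTS/measurable_EFinP.
- by move=> x _; rewrite mule_ge0// lee_fin funrneg_ge0.
- by apply: emeasurable_funM => //; exact/measurable_funTS/measurable_EFinP.
Qed.

(** By [split_abs], the integral of [|k g|] is the sum of those of [|k|] against the two variations,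
    so it is finite exactly when both are. *)
Lemma signed_integrable_density (X : set T) (k : T -> R) : measurable X ->
  signed_integrable G X k <->
  measurable_fun X k /\ Q.-integrable X (fun x => (k x * g x)%:E).
Proof.
move=> mX.
have mX' : measurable_fun X k -> measurable_fun X (fun x => (k x * g x)%:E).
  by move=> mk; apply/measurable_EFinP/measurable_funM => //; exact: measurable_funTS.
have mak : measurable_fun X k -> measurable_fun X (fun x => `|(k x)%:E|).
  by move=> mk; apply: measurableT_comp => //; exact/measurable_EFinP.
split=> [[/integrableP[/measurable_EFinP mk ip] /integrableP[_ ineg]]|[mk]].
  split => //; apply/integrableP; split; first exact: mX'.
  rewrite split_abs// lte_add_pinfty//.
    by rewrite -integral_positive_variation//; exact: mak.
  by rewrite -integral_negative_variation//; exact: mak.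
move=> /integrableP[_]; rewrite split_abs// => h.
have p0 : 0 <= \int[Q]_(x in X) (`|(k x)%:E| * (g^\+ x)%:E).
  by apply: integral_ge0 => x _; rewrite mule_ge0// lee_fin funrpos_ge0.
have n0 : 0 <= \int[Q]_(x in X) (`|(k x)%:E| * (g^\- x)%:E).
  by apply: integral_ge0 => x _; rewrite mule_ge0// lee_fin funrneg_ge0.
split; apply/integrableP; split; first exact/measurable_EFinP.
- rewrite integral_positive_variation//; last exact: mak.
  by apply: le_lt_trans h; rewrite leeDl.
- exact/measurable_EFinP.
- rewrite integral_negative_variation//; last exact: mak.
  by apply: le_lt_trans h; rewrite leeDr.
Qed.

Lemma signed_integral_density (X : set T) (k : T -> R) : measurable X ->
  measurable_fun X k -> Q.-integrable X (fun x => (k x * g x)%:E) ->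
  signed_integral G X k = (\int[Q]_(x in X) (k x * g x))%R.
Proof.
move=> mX mk ikg.
have mkE : measurable_fun X (EFin \o k) by exact/measurable_EFinP.
have [ip ineg] : signed_integrable G X k by apply/signed_integrable_density.
have mgpE : measurable_fun X (EFin \o g^\+%R).
  exact/measurable_funTS/measurable_EFinP.
have mgnE : measurable_fun X (EFin \o g^\-%R).
  exact/measurable_funTS/measurable_EFinP.
have key (f : T -> R) : measurable_fun X (EFin \o f) -> (forall x, (0 <= f x)%R) ->
    (forall x, (f x <= `|g x|)%R) ->
    Q.-integrable X (fun x => (k x * f x)%:E).
  move=> mf f0 fg; apply: le_integrable ikg => //.
    under eq_fun do rewrite EFinM; exact: emeasurable_funM.
  move=> x _; rewrite lee_fin !normrM ler_wpM2l// ger0_norm//.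
have ikp : Q.-integrable X (fun x => (k x * g^\+ x)%:E).
  apply: key => // x.
  by rewrite /funrpos ge_max ler_norm normr_ge0.
have ikn : Q.-integrable X (fun x => (k x * g^\- x)%:E).
  apply: key => // x.
  by rewrite /funrneg ge_max -normrN ler_norm normr_ge0.
have -> : (\int[Q]_(x in X) (k x * g x))%R =
  (\int[Q]_(x in X) (k x * g^\+ x) - \int[Q]_(x in X) (k x * g^\- x))%R.
  rewrite -RintegralB//; apply: eq_Rintegral => x _.
  by rewrite -mulrBr gBE.
have fe (f : T -> R) (f0 : forall x, (0 <= f x)%R) x (u : R) :
    maxe u%:E 0 * (f x)%:E = maxe (u * f x)%:E 0.
  by rewrite maxe_pMl ?lee_fin// mul0e.
have fn (f : T -> R) (f0 : forall x, (0 <= f x)%R) x (u : R) :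
    maxe (- u%:E) 0 * (f x)%:E = maxe (- (u * f x)%:E) 0.
  by rewrite maxe_pMl ?lee_fin// mul0e EFinM mulNe.
have mkp : measurable_fun X (EFin \o k)^\+ by exact: measurable_funepos.
have mkn : measurable_fun X (EFin \o k)^\- by exact: measurable_funeneg.
have pE : \int[positive_variation G]_(x in X) (k x)%:E =
    \int[Q]_(x in X) (k x * g^\+ x)%:E.
  have [m mE] := positive_variation_measure.
  rewrite -mE integralE [RHS]integralE !mE; congr (_ - _);
    rewrite integral_positive_variation//;
    apply: eq_integral => x _; rewrite ?funeposE ?funenegE.
    by apply: fe; exact: funrpos_ge0.
  by apply: fn; exact: funrpos_ge0.
have nE : \int[negative_variation G]_(x in X) (k x)%:E =
    \int[Q]_(x in X) (k x * g^\- x)%:E.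
  have [m mE] := negative_variation_measure.
  rewrite -mE integralE [RHS]integralE !mE; congr (_ - _);
    rewrite integral_negative_variation//;
    apply: eq_integral => x _; rewrite ?funeposE ?funenegE.
    by apply: fe; exact: funrneg_ge0.
  by apply: fn; exact: funrneg_ge0.
by rewrite /signed_integral pE nE.
Qed.
End signed_densities.

(** * Radon-Nikodym theorem for sigma-finite signed measures *)

Section radon_nikodym_signed.
Local Open Scope ereal_scope.
Context d (T : measurableType d) (R : realType).
Variables (Q : {sigma_finite_measure set T -> \bar R}).
Variables (X : set T) (G : set T -> \bar R).
Hypothesis sG : sigma_finite_signed_measure_on X G.
Hypothesis GQ : G `<< Q.

Let G0 : G set0 = 0. Proof. by case: sG => -[]. Qed.
Let Gs : semi_sigma_additive G. Proof. by case: sG => -[]. Qed.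

Let GU A B : measurable A -> measurable B -> A `&` B = set0 ->
  G (A `|` B) = G A + G B.
Proof.
move=> mA mB AB.
apply: (semi_additiveW G0 (semi_sigma_additive_is_additive G0 Gs)) => //.
exact: measurableU.
Qed.

(** In the sum of [G B] and [G (A \ B)] infinities cannot cancel, because [G] avoids one of the two
    infinite values. *)
Let Gfin A B : measurable A -> measurable B -> B `<=` A ->
  G A \is a fin_num -> G B \is a fin_num.
Proof.
move=> mA mB BA.
have mAB : measurable (A `\` B) by exact: measurableD.
have -> : A = B `|` (A `\` B) by rewrite setDUK.
rewrite GU//; last by rewrite setDE setICA setICr setI0.
rewrite !fin_numE.
case: sG => -[_ + _] _ _ => -[|] h.
  by move: (h _ mB) (h _ mAB); case: (G B) => [r| |]//; case: (G _) => [s| |].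
by move: (h _ mB) (h _ mAB); case: (G B) => [r| |]//; case: (G _) => [s| |].
Qed.

Let radon_nikodym_piece B : measurable B -> G B \is a fin_num ->
  exists f : T -> R, measurable_fun setT f /\
    forall A, measurable A -> A `<=` B -> G A = \int[Q]_(x in A) (f x)%:E.
Proof.
move=> mB GB; pose nu A := G (A `&` B).
have nu0 : nu set0 = 0 by rewrite /nu set0I.
have nufin A : measurable A -> nu A \is a fin_num.
  by move=> mA; apply: (Gfin mB) => //; exact: measurableI.
have nus : semi_sigma_additive nu.
  move=> F mF tF mUF; rewrite /nu setI_bigcupl; apply: Gs.
  - by move=> n; exact: measurableI.
  - apply/trivIsetP => i j _ _ ij; move/trivIsetP : tF => /(_ i j I I ij) Fij.
    by rewrite setIACA Fij set0I.
  - by rewrite -setI_bigcupl; exact: measurableI.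
pose m := isCharge.Build _ _ _ nu nu0 nufin nus.
pose c : {charge set T -> \bar R} := HB.pack nu m.
have cQ : c `<< Q.
  move=> A QA C mC CA; apply: (GQ QA); first exact: measurableI.
  by move=> x [/CA].
exists (fine \o Radon_Nikodym c Q); split.
  by apply: measurableT_comp => //; exact: measurable_int (Radon_Nikodym_integrable cQ).
move=> A mA AB; rewrite -[LHS](_ : nu A = _); last by rewrite /nu setIidl.
rewrite -[LHS]/(c A) (Radon_Nikodym_integral cQ mA); apply: eq_integral => x _.
by rewrite /= fineK// Radon_Nikodym_fin_num.
Qed.

(* The library's theorem is for finite charges: it is applied to each piece of
   a partition of X into sets of finite G-measure. *)
Theorem signed_radon_nikodym : exists g, is_density G Q g.
Proof.
have [_ GX [A XE mA]] := sG.
pose B := seqDU A.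
have mB n : measurable (B n) by apply: seqDU_measurable => k; have [] := mA k.
have GB n : G (B n) \is a fin_num.
  by have [? ?] := mA n; apply: (Gfin (A := A n)) => //; exact: subset_seqDU.
have BX : X = \bigcup_n B n by rewrite XE seqDU_bigcup_eq.
have mX : measurable X by rewrite BX; exact: bigcup_measurable.
have tB : trivIset setT B by exact: trivIset_seqDU.
have /choice[f fP] := fun n => radon_nikodym_piece (mB n) (GB n).
(* The pieces are disjoint, so the partial sums are eventually constant at each point: the limit is
   [f n x] on [B n] and 0 off [X]. *)
pose g x : R := (limn (fun n => \sum_(k < n) (f k x * \1_(B k) x)))%R.
have gE n x : B n x -> g x = f n x.
  move=> Bnx; apply/cvg_lim => //; apply/cvg_ballP => e e0.
  exists n.+1 => // m /= nm.
  rewrite (bigD1 (Ordinal nm))//= big1 ?addr0; last first.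
    move=> k kn; rewrite indicE memNset ?mulr0// => Bkx.
    by move/trivIsetP : tB => /(_ k n I I kn)/seteqP[/(_ x (conj Bkx Bnx))].
  by rewrite indicE mem_set// mulr1; exact: ballxx.
have g0 x : ~ X x -> g x = 0%R.
  move=> nXx; apply/cvg_lim => //; rewrite [X in X @ _ --> _](_ : _ = cst 0%R).
    exact: cvg_cst.
  apply/funext => n; apply: big1 => k _; rewrite indicE memNset ?mulr0// => Bkx.
  by apply: nXx; rewrite BX; exists k.
have mg : measurable_fun setT g.
  have -> : setT = (\bigcup_n B n) `|` ~` X by rewrite -BX setUv.
  apply/measurable_funU => //.
  - by rewrite -BX.
  - exact: measurableC.
  split.
    apply/measurable_fun_bigcup => // n.
    apply: (eq_measurable_fun (f n)).
      by move=> x; rewrite inE => /gE.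
    by apply: measurable_funTS; case: (fP n).
  apply: (eq_measurable_fun (fun=> 0%R : R)); last exact: measurable_cst.
  by move=> x; rewrite inE => /g0.
exists g; split => // C mC.
have intB D n : measurable D -> G (D `&` B n) = \int[Q]_(x in D `&` B n) (g x)%:E.
  move=> mD; have [_ ->] := fP n; [|exact: measurableI|exact: subIsetr].
  by apply: eq_integral => x /[!inE] -[_ /gE ->].
have GDB D : measurable D -> D `<=` X ->
    (fun n => \sum_(0 <= i < n) \int[Q]_(x in D `&` B i) (g x)%:E) @ \oo --> G D.
  move=> mD DX; rewrite -[in X in _ --> X](setIidl DX) BX setI_bigcupr.
  under eq_fun do under eq_bigr do rewrite -intB//.
  apply: Gs.
  - by move=> n; exact: measurableI.
  - apply/trivIsetP => i j _ _ ij; move/trivIsetP : tB => /(_ i j I I ij) Fij.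
    by rewrite setIACA Fij setI0.
  - by rewrite -setI_bigcupr -BX; exact: measurableI.
have DE D : D `<=` X -> D = \bigcup_n (D `&` B n).
  by move=> DX; rewrite -setI_bigcupr -BX setIidl.
have tDB D : trivIset setT (fun n => D `&` B n).
  apply/trivIsetP => i j _ _ ij; move/trivIsetP : tB => /(_ i j I I ij) Fij.
  by rewrite setIACA Fij setI0.
have mgE D : measurable_fun D (EFin \o g).
  by apply/measurable_EFinP; exact: measurable_funTS.
(* Integrals over the pieces add up to the integral over their union where [g] has a constant sign.
   The set [C] is therefore cut according to the sign of [g], and [G] is additive over the two
   parts. *)
have pos D : measurable D -> D `<=` X -> (forall x, D x -> (0 <= g x)%R) ->
    G D = \int[Q]_(x in D) (g x)%:E.
  move=> mD DX g0D; apply: (cvg_unique _ (GDB _ mD DX)) => //.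
  have -> : \int[Q]_(x in D) (g x)%:E =
      \sum_(i <oo) \int[Q]_(x in D `&` B i) (g x)%:E.
    rewrite [in LHS](DE _ DX) ge0_integral_bigcup//.
    - by move=> n; exact: measurableI.
    - by move=> x [n _ [Dx _]]; rewrite lee_fin g0D.
  apply: is_cvg_ereal_nneg_natsum_cond => n _ _.
  by apply: integral_ge0 => x [Dx _]; rewrite lee_fin g0D.
have neg D : measurable D -> D `<=` X -> (forall x, D x -> (g x <= 0)%R) ->
    G D = - \int[Q]_(x in D) (- (g x)%:E).
  move=> mD DX g0D; apply: (cvg_unique _ (GDB _ mD DX)) => //.
  have -> : \int[Q]_(x in D) (- (g x)%:E) =
      \sum_(i <oo) \int[Q]_(x in D `&` B i) (- (g x)%:E).
    rewrite [in LHS](DE _ DX) ge0_integral_bigcup//.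
    - by move=> n; exact: measurableI.
    - by apply: measurableT_comp => //; exact: mgE.
    - by move=> x [n _ [Dx _]]; rewrite lee_fin oppr_ge0 g0D.
  rewrite (_ : (fun n => _) = (fun n =>
      - \sum_(0 <= i < n) \int[Q]_(x in D `&` B i) (- (g x)%:E))); last first.
    apply/funext => n; rewrite -sumeN; last first.
      move=> i j _ _; apply: ge0_adde_def; rewrite inE;
      by apply: integral_ge0 => x [Dx _]; rewrite lee_fin oppr_ge0 g0D.
    apply: eq_bigr => k _; rewrite -integral_ge0N; last first.
      by move=> x [Dx _]; rewrite lee_fin oppr_ge0 g0D.
    by apply: eq_integral => x _; rewrite oppeK.
  apply: cvgeN; apply: is_cvg_ereal_nneg_natsum_cond => n _ _.
  by apply: integral_ge0 => x [Dx _]; rewrite lee_fin oppr_ge0 g0D.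
pose P := [set x | (0 <= g x)%R].
have mP : measurable P.
  by rewrite -[X in measurable X]setTI; exact: measurable_fun_le.
have mCX D : measurable D -> measurable (D `&` X).
  by move=> mD; exact: measurableI.
have GX' D : measurable D -> G D = G (D `&` X).
  move=> mD; rewrite -[in LHS](setIT D) -(setUv X) setIUr GU//.
  - by rewrite [X in _ + X]GX ?adde0//; apply: measurableI => //; exact: measurableC.
  - exact: mCX.
  - by apply: measurableI => //; exact: measurableC.
  - by rewrite setIACA setICr setI0.
have -> : G C = G (C `&` P) + G (C `&` ~` P).
  rewrite -[in LHS](setIT C) -(setUv P) setIUr GU//.
  - exact: measurableI.
  - by apply: measurableI => //; exact: measurableC.
  - by rewrite setIACA setICr setI0.
have mCP : measurable (C `&` P) by exact: measurableI.
have mCN : measurable (C `&` ~` P) by apply: measurableI => //; exact: measurableC.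
rewrite GX'// [in X in _ + X]GX'// pos//; last 2 first.
- exact: mCX.
- by move=> x [[]].
rewrite neg//; last 2 first.
- exact: mCX.
- by move=> x [[_ /negP]]; rewrite -ltNge => /ltW.
rewrite [RHS]integralE; congr (_ - _).
  rewrite -setIA integral_mkcondr; apply: eq_integral => x _.
  rewrite patchE funeposE; case: ifPn.
    by rewrite inE => -[Px _]; rewrite max_l// lee_fin.
  rewrite notin_setE => /not_andP[|/g0 ->]; last by rewrite maxxx.
  by move=> /negP; rewrite -ltNge => gx; rewrite max_r// lee_fin ltW.
rewrite -setIA integral_mkcondr; apply: eq_integral => x _.
rewrite patchE funenegE; case: ifPn.
  rewrite inE => -[/negP]; rewrite -ltNge => gx _.
  by rewrite max_l// lee_fin oppr_ge0 ltW.
rewrite notin_setE => /not_andP[/contrapT Px|/g0 ->]; last by rewrite oppe0 maxxx.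
by rewrite max_r// lee_fin oppr_le0.
Qed.

End radon_nikodym_signed.

(** * The quantile measure *)

Section quantile_pushforward.
Variables (R : realType) (F : cumulativeBounded (0 : R) (1 : R)).

(** Right continuity of [F] makes the infimum that defines the quantile a minimum; the limits of [F]
    at the two infinities make the set nonempty and bounded below. Every comparison of [Q] with
    Lebesgue measure goes through this equivalence. *)
Lemma quantile_le (u x : R) : 0 < u < 1 -> (quantile F u <= x) = (u <= F x).
Proof.
move=> /andP[u0 u1]; set S := [set x | u <= F x].
have [M [_ hM]] : \forall x \near +oo, u <= F x.
  by apply: (cvgr_ge _ (cumulativey F)).
have [m [_ hm]] : \forall x \near -oo, F x < u.
  by apply: (cvgr_lt _ (cumulativeNy F)).
have Sm : lbound S m.
  by move=> y /= Sy; rewrite leNgt; apply/negP => /hm; rewrite ltNge Sy.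
have infS : has_inf S by split; [exists (M + 1); apply: hM; rewrite ltrDl|exists m].
apply/idP/idP => [qx|Fx]; last by apply: ge_inf => //; exists m.
apply: (@le_trans _ _ (F (quantile F u))); last exact: cumulative_is_nondecreasing.
rewrite leNgt; apply/negP => Fq.
have /= := cumulative_is_right_continuous F (quantile F u).
move=> /cvgr_lt /(_ u Fq) [e /= e0 he].
have [y Sy yq] := inf_adherent e0 infS.
have qy : quantile F u <= y by apply: ge_inf => //; exists m.
move: qy; rewrite le_eqVlt => /predU1P[qy|qy].
  by move: Sy Fq; rewrite /S /= -qy => /le_lt_trans/[apply]; rewrite ltxx.
have : F y < u.
  by apply: he => //=; rewrite ltr0_norm ?subr_lt0// opprB ltrBlDl.
by rewrite ltNge Sy.
Qed.

Lemma preimage_cumulative_itv (s t : R) : 0 < s < 1 -> 0 < t < 1 ->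
  F @^-1` `[s, t[%classic = `[quantile F s, quantile F t[%classic.
Proof.
move=> s01 t01; apply/seteqP; split => x /=; rewrite !in_itv /=.
  by rewrite !ltNge !quantile_le.
by rewrite !ltNge !quantile_le.
Qed.

Lemma measurable_cumulative :
  measurable_fun [set: measurableTypeR R] (F : measurableTypeR R -> measurableTypeR R).
Proof.
apply: nondecreasing_measurable => // x y *; exact: cumulative_is_nondecreasing.
Qed.

Lemma measurable_open01 : measurable (open01 R).
Proof.
rewrite (_ : open01 R = `]0, 1[%classic); first exact: measurable_itv.
by apply/seteqP; split => x /=; rewrite in_itv.
Qed.

(** Half-open, like the intervals on which a quantile measure is prescribed. The shift in [n.+2]
    keeps both endpoints inside [(0, 1)], where quantiles are controlled; the first interval is
    empty. *)
Definition open01_exhaustion (n : nat) : set (measurableTypeR R) :=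
  `[n.+2%:R^-1, 1 - n.+2%:R^-1[%classic.

Lemma open01_exhaustion_gt0 n : 0 < (n.+2%:R^-1 : R) < 1.
Proof. by rewrite invr_gt0 ltr0n /= invf_lt1 ?ltr0n// ltr1n. Qed.

Lemma measurable_open01_exhaustion n : measurable (open01_exhaustion n).
Proof. exact: measurable_itv. Qed.

Lemma nondecreasing_open01_exhaustion : nondecreasing_seq open01_exhaustion.
Proof.
move=> m n mn; rewrite subsetEset /open01_exhaustion => x /=.
rewrite !in_itv /= => /andP[mx xm].
have nm : n.+2%:R^-1 <= m.+2%:R^-1 :> R.
  by rewrite lef_pV2 ?posrE ?ltr0n// ler_nat !ltnS.
by rewrite (le_trans nm)//= (lt_le_trans xm)// lerB.
Qed.

Lemma bigcup_open01_exhaustion : \bigcup_n open01_exhaustion n = open01 R.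
Proof.
apply/seteqP; split => [x [n _]|x /= /andP[x0 x1]].
  rewrite /open01_exhaustion /= in_itv /= => /andP[nx xn].
  have /andP[n0 n1] := open01_exhaustion_gt0 n.
  by rewrite /open01 /= (lt_le_trans n0)//= (lt_trans xn)// ltrBlDr ltrDl.
have e0 : 0 < Num.min x (1 - x) by rewrite lt_min x0 subr_gt0.
have [n hn] : exists n : nat, n.+2%:R^-1 < Num.min x (1 - x).
  exists (Num.truncn (Num.min x (1 - x))^-1).
  rewrite invf_plt ?posrE ?ltr0n//.
  by apply: lt_trans (truncnS_gt _) _; rewrite ltr_nat.
exists n => //; move: hn; rewrite lt_min => /andP[nx n1].
by rewrite /open01_exhaustion /= in_itv /= (ltW nx)/= ltrBrDl -ltrBrDr.
Qed.

Lemma preimage_open01_exhaustion n :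
  F @^-1` open01_exhaustion n =
  `[quantile F n.+2%:R^-1, quantile F (1 - n.+2%:R^-1)[%classic.
Proof.
have /andP[n0 n1] := open01_exhaustion_gt0 n.
by rewrite preimage_cumulative_itv// ?n0 ?n1// subr_gt0 n1 /= ltrBlDr ltrDl.
Qed.

Local Notation mu := (@lebesgue_measure R).

Lemma lebesgue_preimage_open01_exhaustion n :
  (mu (F @^-1` open01_exhaustion n) < +oo)%E.
Proof.
rewrite preimage_open01_exhaustion lebesgue_measure_itv /=.
by case: ifPn => _; rewrite ?ltry// -EFinB ltry.
Qed.

Variable Q : {sigma_finite_measure set (measurableTypeR R) -> \bar R}.
Hypothesis QF : quantile_measure F Q.

Let mF := measurable_cumulative.

Let Q_itv (s t : R) : 0 < s < 1 -> 0 < t < 1 ->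
  Q `[s, t[%classic = mu (F @^-1` `[s, t[%classic).
Proof.
move=> /[dup] s01 /andP[s0 s1] /[dup] t01 /andP[t0 t1].
have [st|ts] := leP s t; last first.
  by rewrite set_itv_ge -?leNgt ?bnd_simp ?ltW// preimage_set0 !measure0.
rewrite preimage_cumulative_itv// (proj2 QF)// lebesgue_measure_itv /= lte_fin.
case: ltP => // qts; rewrite (_ : quantile F t = quantile F s) ?subrr//.
apply/eqP; rewrite eq_le qts/= quantile_le//.
by rewrite (le_trans st)// -quantile_le.
Qed.

(** A ray [[x, +oo)] meets a piece of the exhaustion in a half-open interval, where both sides agree
    by [Q_itv]. Rays are stable under intersection and generate the Borel sets, so uniqueness of
    finite measures gives equality on each piece; a monotone limit then gives it on [(0, 1)], which
    carries [Q]. *)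
Lemma quantile_measureE A : measurable A ->
  Q A = mu (F @^-1` A `&` F @^-1` open01 R).
Proof.
move=> mA.
have QI n B : measurable B ->
    Q (B `&` open01_exhaustion n) = mu (F @^-1` (B `&` open01_exhaustion n)).
  move=> mB.
  have mI := measurable_open01_exhaustion n.
  pose m1 : {measure set (measurableTypeR R) -> \bar R} := mrestr Q mI.
  pose m2 : {measure set (measurableTypeR R) -> \bar R} :=
    mrestr (pushforward mu (F : measurableTypeR R -> measurableTypeR R)) mI.
  suff: m1 B = m2 mF B by [].
  have /andP[s0 s1] := open01_exhaustion_gt0 n.
  have t01 : 0 < (1 - n.+2%:R^-1 : R) < 1.
    by rewrite subr_gt0 s1 /= ltrBlDr ltrDl.
  apply: (@measure_unique _ R (measurableTypeR R) (@RGenCInfty.G R)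
    (fun k => `[- k%:R, +oo[%classic) _ _ _ _ m1 (m2 mF)) => //.
  - exact: RGenCInfty.measurableE.
  - move=> _ _ [x ->] [y ->]; exists (Num.max x y).
    by apply/seteqP; split => z /=; rewrite !in_itv /= !andbT ge_max => /andP.
  - by move=> k; exists (- k%:R).
  - apply/seteqP; split => // x _; exists (Num.truncn `|x|).+1 => //=.
    rewrite in_itv /= andbT lerNl (le_trans (ler_norm _))// normrN.
    exact/ltW/truncnS_gt.
  - move=> _ [x ->]; rewrite /m1 /m2 /= /mrestr /pushforward.
    have -> : `[x, +oo[%classic `&` open01_exhaustion n =
        `[Num.max x n.+2%:R^-1, 1 - n.+2%:R^-1[%classic.
      rewrite /open01_exhaustion.
      by apply/seteqP; split => z /=; rewrite !in_itv /= ge_max andbT;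
        [move=> [-> /andP[-> ->]]|move=> /andP[/andP[-> ->] ->]].
    have [xt|tx] := ltP (Num.max x n.+2%:R^-1) (1 - n.+2%:R^-1 : R).
      rewrite Q_itv// (lt_trans xt) ?andbT; last by case/andP : t01.
      by rewrite lt_max s0 orbT.
    by rewrite set_itv_ge ?bnd_simp -?leNgt// preimage_set0 !measure0.
  - move=> k; rewrite /m1 /= /mrestr.
    apply: (@le_lt_trans _ _ (Q (open01_exhaustion n))).
      by apply: le_measure; rewrite ?inE//; exact: measurableI.
    rewrite /open01_exhaustion Q_itv// ?s0//.
    exact: lebesgue_preimage_open01_exhaustion.
have cvgQ : (fun n => Q (A `&` open01_exhaustion n)) @ \oo --> Q (A `&` open01 R).
  rewrite -bigcup_open01_exhaustion setI_bigcupr; apply: nondecreasing_cvg_mu => //.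
  - by move=> n; apply: measurableI => //; exact: measurable_open01_exhaustion.
  - apply: bigcup_measurable => n _; apply: measurableI => //.
    exact: measurable_open01_exhaustion.
  - move=> m n mn; rewrite subsetEset; apply: setIS.
    by rewrite -subsetEset; exact: nondecreasing_open01_exhaustion.
have cvgmu : (fun n => mu (F @^-1` (A `&` open01_exhaustion n))) @ \oo -->
    mu (F @^-1` A `&` F @^-1` open01 R).
  rewrite -preimage_setI -bigcup_open01_exhaustion setI_bigcupr preimage_bigcup.
  apply: nondecreasing_cvg_mu => //.
  - move=> n; rewrite -[X in measurable X]setTI; apply: mF => //.
    by apply: measurableI => //; exact: measurable_open01_exhaustion.
  - apply: bigcup_measurable => n _; rewrite -[X in measurable X]setTI.
    apply: mF => //.
    by apply: measurableI => //; exact: measurable_open01_exhaustion.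
  - move=> m n mn; rewrite subsetEset; apply: preimage_subset; apply: setIS.
    by rewrite -subsetEset; exact: nondecreasing_open01_exhaustion.
have mX := measurable_open01.
have -> : Q A = Q (A `&` open01 R).
  rewrite -[in LHS](setIT A) -(setUv (open01 R)) setIUr measureU//.
  - rewrite [X in (_ + X)%E](_ : _ = 0%E) ?adde0//.
    apply: (subset_measure0 (B := ~` open01 R)) => //; last by case: QF.
    + by apply: measurableI => //; exact: measurableC.
    + exact: measurableC.
  - exact: measurableI.
  - by apply: measurableI => //; exact: measurableC.
  - by rewrite setIACA setICr setI0.
apply: (cvg_unique _ cvgQ) => //=.
by under eq_fun do rewrite QI//.
Qed.

End quantile_pushforward.

(** * Convex divergences *)

Section convex_divergence.
Variables (R : realType) (phi : R -> \bar R) (a b : \bar R).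
Hypothesis phi_ge0 : forall x, (0 <= phi x)%E.
Hypothesis phi_convex : strictly_convex phi.
Hypothesis phi1 : phi 1 = 0%E.
Hypothesis phi_dom : [set x | (phi x < +oo)%E] = [set x | (a < x%:E < b)%E].
Hypothesis ab1 : (a < 1 < b)%E.

Let dom x : (phi x < +oo)%E = (a < x%:E < b)%E.
Proof. by move/seteqP : phi_dom => [h1 h2]; apply/idP/idP => [/h1|/h2]. Qed.

Let f x : R := fine (phi x).

Let fE x : (a < x%:E < b)%E -> phi x = (f x)%:E.
Proof. by rewrite -dom => xdom; rewrite fineK// ge0_fin_numE. Qed.

Let f_ge0 x : 0 <= f x. Proof. exact: fine_ge0. Qed.

Let f1 : f 1 = 0. Proof. by rewrite /f phi1. Qed.

Let dom_itv x y z : (a < x%:E < b)%E -> (a < y%:E < b)%E -> x <= z <= y ->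
  (a < z%:E < b)%E.
Proof.
move=> /andP[ax xb] /andP[ay yb] /andP[xz zy].
by rewrite (lt_le_trans ax) ?lee_fin//= (le_lt_trans _ yb) ?lee_fin.
Qed.

Let dom_below y : (a < y%:E < b)%E -> exists2 z, z < y & (a < z%:E < b)%E.
Proof.
move=> /andP[ay yb]; case: a ay => [r| |]; [|by rewrite ltNge leey|]; last first.
  exists (y - 1); first by rewrite ltrBlDr ltrDl.
  by rewrite ltNyr/= (lt_trans _ yb)// lte_fin ltrBlDr ltrDl.
rewrite lte_fin => ry; have := midf_lt ry => -[h1 h2].
exists ((r + y) / 2) => //.
by rewrite lte_fin h1/= (lt_trans _ yb)// lte_fin.
Qed.

Let dom_above y : (a < y%:E < b)%E -> exists2 z, y < z & (a < z%:E < b)%E.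
Proof.
move=> /andP[ay yb]; case: b yb => [r| |]; [| |by rewrite ltNge leNye]; last first.
  exists (y + 1); first by rewrite ltrDl.
  by rewrite ltry andbT (lt_trans ay)// lte_fin ltrDl.
rewrite lte_fin => ry; have := midf_lt ry => -[h1 h2].
exists ((y + r) / 2) => //.
by rewrite [X in _ && X]lte_fin h2 andbT (lt_trans ay)// lte_fin.
Qed.

(** Strict convexity cleared of its denominators, in a form fit for linear arithmetic. *)
Let convex_real x y z : (a < x%:E < b)%E -> (a < y%:E < b)%E -> x < z < y ->
  (y - x) * f z < (y - z) * f x + (z - x) * f y.
Proof.
move=> xd yd /andP[xz zy].
have zd : (a < z%:E < b)%E by apply: dom_itv xd yd _; rewrite !ltW.
have xy : x < y by exact: lt_trans zy.
have yx0 : 0 < y - x by rewrite subr_gt0.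
pose t := (y - z) / (y - x).
have t01 : 0 < t < 1.
  by rewrite divr_gt0 ?subr_gt0//= ltr_pdivrMr// mul1r ltrD2l ltrN2.
have tE : t * x + (1 - t) * y = z by rewrite /t; field; rewrite gt_eqF.
have xNy : x != y by rewrite lt_eqF.
have := phi_convex xNy _ _ t01; rewrite !dom xd yd tE => /(_ isT isT).
rewrite (fE xd) (fE yd) (fE zd) -!EFinM -EFinD lte_fin.
rewrite (_ : (y - z) * f x + (z - x) * f y =
    (y - x) * (t * f x + (1 - t) * f y)) ?ltr_pM2l//.
by rewrite /t; field; rewrite gt_eqF.
Qed.

(** The left derivative of [phi] at [y]: chord slopes increase towards [y], so their supremum is
    their limit. It is meaningful only in the domain, whose openness provides chords on both
    sides. *)
Definition divergence_slope y : R :=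
  sup [set (f y - f z) / (y - z) | z in [set z | z < y /\ (a < z%:E < b)%E]].

Let slope_le x y z : (a < x%:E < b)%E -> (a < y%:E < b)%E -> x < z < y ->
  (f z - f x) / (z - x) <= (f y - f z) / (y - z).
Proof.
move=> xd yd /[dup] xzy /andP[xz zy].
rewrite ler_pdivrMr ?subr_gt0// mulrAC ler_pdivlMr ?subr_gt0//.
have := convex_real xd yd xzy; lra.
Qed.

Let slope_has_sup y : (a < y%:E < b)%E ->
  has_sup [set (f y - f z) / (y - z) | z in [set z | z < y /\ (a < z%:E < b)%E]].
Proof.
move=> yd; have [u uy ud] := dom_below yd; have [w yw wd] := dom_above yd.
split; first by exists ((f y - f u) / (y - u)); exists u.
exists ((f w - f y) / (w - y)) => _ [z [zy zd] <-].
by apply: slope_le => //; rewrite zy.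
Qed.

(** This is the supporting line at [y]. Chords on the left of [y] have slope at most the supremum;
    chords on the right bound every left chord and hence the supremum. Off the domain the right-hand
    side is [+oo]. *)
Lemma divergence_slopeP y z : (a < y%:E < b)%E ->
  ((f y + divergence_slope y * (z - y))%:E <= phi z)%E.
Proof.
move=> yd; case: (boolP (a < z%:E < b)%E) => [zd|]; last first.
  by rewrite -dom -leNgt leye_eq => /eqP ->; exact: leey.
rewrite (fE zd) lee_fin.
have [zy|yz|->] := ltgtP z y; last by rewrite subrr mulr0 addr0.
  have : (f y - f z) / (y - z) <= divergence_slope y.
    by apply: ub_le_sup; [exact: (slope_has_sup yd).2|exists z].
  by rewrite ler_pdivrMr ?subr_gt0//; lra.
have : divergence_slope y <= (f z - f y) / (z - y).
  apply: ge_sup; first exact: (slope_has_sup yd).1.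
  by move=> _ [u [uy ud] <-]; apply: slope_le => //; rewrite uy.
by rewrite ler_pdivlMr ?subr_gt0//; lra.
Qed.

Let mdom : measurable [set x : R | (a < x%:E < b)%E].
Proof.
apply: is_interval_measurable => x y /= xd yd z; exact: dom_itv.
Qed.

(** Adding the supporting inequalities at two points shows that the slope is nondecreasing, so its
    superlevel sets are intervals. *)
Lemma measurable_divergence_slope :
  measurable_fun [set x : R | (a < x%:E < b)%E] divergence_slope.
Proof.
have slope_nd x y : (a < x%:E < b)%E -> (a < y%:E < b)%E -> x <= y ->
    divergence_slope x <= divergence_slope y.
  move=> xd yd; rewrite le_eqVlt => /predU1P[->//|xy].
  have := divergence_slopeP y xd; have := divergence_slopeP x yd.
  rewrite (fE xd) (fE yd) !lee_fin => h1 h2.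
  rewrite -(ler_pM2r (_ : 0 < y - x)) ?subr_gt0//; lra.
apply: (measurability _ (RGenCInfty.measurableE R)) => // _ [_ [r ->] <-].
apply: is_interval_measurable => s t/=.
rewrite !in_itv/= !andbT => -[sd fs] [td ft] u /[dup] sut /andP[su ut].
have ud : (a < u%:E < b)%E by exact: dom_itv sut.
by rewrite in_itv/= andbT (le_trans fs)// slope_nd.
Qed.

(** Convexity makes the strict sublevel sets intervals. *)
Lemma measurable_divergence : measurable_fun setT phi.
Proof.
apply: (measurability _ (ErealGenInftyO.measurableE R)) => _ [_ [c ->] <-].
rewrite setTI; apply: is_interval_measurable => x y /=; rewrite !in_itv /= => xc yc z.
move=> /andP[]; rewrite le_eqVlt => /predU1P[<-//|xz].
rewrite le_eqVlt => /predU1P[->//|zy].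
have xd : (a < x%:E < b)%E by rewrite -dom (lt_trans xc)// ltry.
have yd : (a < y%:E < b)%E by rewrite -dom (lt_trans yc)// ltry.
have zd : (a < z%:E < b)%E by apply: dom_itv xd yd _; rewrite !ltW.
have xzy : x < z < y by rewrite xz.
have := convex_real xd yd xzy.
move: xc yc; rewrite (fE xd) (fE yd) (fE zd) !lte_fin => xc yc h.
rewrite in_itv/= lte_fin -(ltr_pM2l (_ : 0 < y - x)) ?subr_gt0 ?(lt_trans xz)//.
apply: (lt_trans h).
have : (y - z) * f x < (y - z) * c by rewrite ltr_pM2l ?subr_gt0.
have : (z - x) * f y < (z - x) * c by rewrite ltr_pM2l ?subr_gt0.
lra.
Qed.

(** By strict convexity, a second zero would make [phi] negative halfway between it and 1. *)
Let f_gt0 x : (a < x%:E < b)%E -> x != 1 -> 0 < f x.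
Proof.
move=> xd x1; rewrite lt_neqAle f_ge0 andbT; apply/eqP => fx.
have h1 : (a < (1 : R)%:E < b)%E by [].
have fxE : f x = 0 by [].
have [x1'|x1'] := ltP x 1.
  have [h2 h3] := midf_lt x1'.
  have := @convex_real x 1 ((x + 1) / 2) xd h1; rewrite h2 h3 fxE f1 => /(_ isT).
  by rewrite !mulr0 addr0 pmulr_rlt0 ?subr_gt0// ltNge f_ge0.
have {}x1' : 1 < x by rewrite lt_neqAle eq_sym x1.
have [h2 h3] := midf_lt x1'.
have := @convex_real 1 x ((1 + x) / 2) h1 xd; rewrite h2 h3 fxE f1 => /(_ isT).
by rewrite !mulr0 addr0 pmulr_rlt0 ?subr_gt0// ltNge f_ge0.
Qed.

(** Supporting lines at points [y0 < 1 < y1] have nonzero slopes of opposite signs, because [phi]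
    vanishes at 1 and is positive at both points. The line at [y1] bounds [z] from above, the line
    at [y0] from below. *)
Lemma divergence_growth : exists2 C : R, 0 < C & forall z,
  ((`|z|)%:E <= C%:E * (1 + phi z))%E /\ ((- z)%:E <= C%:E * phi z)%E.
Proof.
have h1 : (a < (1 : R)%:E < b)%E by [].
have [y1 y11 y1d] := dom_above h1.
have [u u1 ud] := dom_below h1.
(* With [y0] nonnegative, the term [s0 * y0] of the supporting line has the sign that allows it to
   be dropped from the bound on [- z]. *)
pose y0 := Num.max u 0.
have y01 : y0 < 1 by rewrite gt_max u1 ltr01.
have y00 : 0 <= y0 by rewrite le_max lexx orbT.
have y0d : (a < y0%:E < b)%E.
  by apply: dom_itv ud h1 _; rewrite le_max lexx/= ltW.
set s1 := divergence_slope y1; set s0 := divergence_slope y0.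
have fy1 : 0 < f y1 by apply: f_gt0 => //; rewrite gt_eqF.
have fy0 : 0 < f y0 by apply: f_gt0 => //; rewrite lt_eqF.
have s1_gt0 : 0 < s1.
  have := divergence_slopeP 1 y1d; rewrite phi1 lee_fin -/s1 => h.
  by rewrite -(pmulr_lgt0 _ (_ : 0 < y1 - 1)) ?subr_gt0//; lra.
have s0_gt0 : 0 < - s0.
  have := divergence_slopeP 1 y0d; rewrite phi1 lee_fin -/s0 => h.
  by rewrite -(pmulr_lgt0 _ (_ : 0 < 1 - y0)) ?subr_gt0//; lra.
have s1V : 0 < s1^-1 by rewrite invr_gt0.
have s0V : 0 < (- s0)^-1 by rewrite invr_gt0.
(* The bounds are [z <= y1 + s1^-1 * r] and [- z <= (- s0)^-1 * r] with [r = phi z]; the sum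
   dominates all three constants. *)
pose C := y1 + s1^-1 + (- s0)^-1.
have C0 : 0 < C by rewrite !addr_gt0// (lt_trans _ y11).
exists C => // z; have := divergence_slopeP z y1d; have := divergence_slopeP z y0d.
rewrite -/s0 -/s1; move: (phi_ge0 z).
case: (phi z) => [r|_ _ _|//]; last first.
  by rewrite addey// !gt0_muley ?lte_fin// !leey.
rewrite -EFinD -!EFinM !lee_fin => r0 h0 h1'.
have zr1 : z <= y1 + s1^-1 * r.
  rewrite -lerBlDl -(ler_pM2l s1_gt0) mulVKf ?gt_eqF//; lra.
have zr0 : - z <= (- s0)^-1 * r.
  rewrite -(ler_pM2l s0_gt0) mulVKf ?gt_eqF//.
  have : 0 <= - s0 * y0 by rewrite mulr_ge0// ltW.
  lra.
have y10 : 0 < y1 by rewrite (lt_trans _ y11).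
have : 0 <= y1 * r by rewrite mulr_ge0// ltW.
have : 0 <= s1^-1 * r by rewrite mulr_ge0// ltW.
have : 0 <= (- s0)^-1 * r by rewrite mulr_ge0// ltW.
rewrite /C => k1 k2 k3; split; last lra.
rewrite ler_norml; apply/andP; split; lra.
Qed.

End convex_divergence.

(** * Completed Lebesgue measure and derivatives *)

Section completed_lebesgue_integral.
Local Open Scope ereal_scope.
Variable R : realType.
Local Notation mu := (@lebesgue_measure R).
Local Notation cmu := (@completed_lebesgue_measure R).
Local Notation cR := (caratheodory_type (@wlength R idfun)^*%mu).

Lemma measurable_id_completed :
  measurable_fun [set: cR] (id : cR -> measurableTypeR R).
Proof. by move=> _ A mA; rewrite setTI; exact: sub_caratheodory. Qed.

Lemma measurable_fun_completed d (T : measurableType d) (f : R -> T) :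
  measurable_fun [set: measurableTypeR R] f -> measurable_fun [set: cR] f.
Proof.
by move=> mf; exact: (measurableT_comp mf measurable_id_completed).
Qed.

(** Lebesgue measure is the image of its completion under the identity, so this is a change of
    variables. *)
Lemma ge0_integral_completed (f : R -> \bar R) :
  measurable_fun [set: measurableTypeR R] f -> (forall x, 0 <= f x) ->
  \int[cmu]_x f x = \int[mu]_x f x.
Proof.
move=> mf f0.
have := @ge0_integral_pushforward _ _ cR (measurableTypeR R) R id
  measurable_id_completed cmu setT f measurableT mf.
by rewrite preimage_setT => <-// y _.
Qed.

Lemma integral_completed (f : R -> \bar R) :
  measurable_fun [set: measurableTypeR R] f ->
  \int[cmu]_x f x = \int[mu]_x f x.
Proof.
move=> mf; rewrite integralE [RHS]integralE; congr (_ - _);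
  apply: ge0_integral_completed => //.
  exact: measurable_funepos.
exact: measurable_funeneg.
Qed.

Lemma ae_completed (P : R -> Prop) :
  {ae mu, forall x, P x} -> {ae cmu, forall x, P x}.
Proof.
by move=> [N [mN N0 PN]]; exists N; split => //; exact: sub_caratheodory.
Qed.

Section ae_equal.
Variables (f g : R -> \bar R).
Hypotheses (mf : measurable_fun [set: measurableTypeR R] f)
  (fg : {ae cmu, forall x, f x = g x}).

Let fgE : ae_eq cmu [set: cR] f g.
Proof.
case: fg => N [mN N0 sN]; exists N; split => // x /= fgx; apply: sN => /= h.
by apply: fgx.
Qed.

(** Completeness of the measure passes measurability on to [g], of which only an almost everywhere
    equality is known. *)
Let mg : measurable_fun [set: cR] g.
Proof.
apply: (ae_measurable_fun completed_lebesgue_measure_is_complete (f := f)).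
  exact: fgE.
exact: measurable_fun_completed.
Qed.

Lemma ae_integral_completed : \int[cmu]_x g x = \int[mu]_x f x.
Proof.
rewrite -integral_completed//; apply: ae_eq_integral => //.
  exact: measurable_fun_completed.
exact: ae_eq_sym.
Qed.

Lemma ae_integrable_completed :
  cmu.-integrable setT g <-> mu.-integrable setT f.
Proof.
have e : \int[cmu]_x `|g x| = \int[mu]_x `|f x|.
  rewrite -ge0_integral_completed//; last exact: measurableT_comp.
  apply: ae_eq_integral => //; first exact: measurableT_comp.
    apply: measurableT_comp => //; exact: measurable_fun_completed.
  apply: (@filterS _ _ (ae_filter_ringOfSetsType cmu) _ _ _ fgE).
  by move=> x fgx xT; rewrite fgx.
by split => /integrableP[_ h]; apply/integrableP; split => //;
  [rewrite -e|rewrite e].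
Qed.

End ae_equal.

End completed_lebesgue_integral.

(** * Derivatives and primitives almost everywhere *)

Section derivative_representatives.
Variable R : realType.
Local Notation mu := (@lebesgue_measure R).
Implicit Types (f h T : R -> R) (x : R).

(** The increment over [[p, q]] is cut at [x]: each part has an error of at most [e] times its
    length, and the lengths add up. A mesh interval contains [x] without having it as an endpoint,
    so the one-sided quotients of the definition do not apply directly. *)
Lemma derivable_straddle f x (e : R) : derivable f x 1 -> 0 < e ->
  exists2 d : R, 0 < d & forall p q, p <= x <= q -> q - p < d ->
    `|f q - f p - derive1 f x * (q - p)| <= e * (q - p).
Proof.
move=> fx e0.
pose g (h : R) := h^-1 *: (f (h + x) - f x).
have cg : g h @[h --> 0^'] --> derive1 f x.
  have := fx; rewrite /derivable /shift /= /derive1.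
  by rewrite (_ : (fun h : R => _) = g)//;
    apply/funext => h; rewrite -[h%:A]/(h * 1) mulr1.
move/cvgrPdist_lt : cg => /(_ e e0) [d /= d0 hd].
have key y : `|y - x| < d -> `|f y - f x - derive1 f x * (y - x)| <= e * `|y - x|.
  have [->|yx] := eqVneq y x; first by rewrite !subrr mulr0 subr0 normr0 mulr0.
  move=> yd; have yx0 : y - x != 0 by rewrite subr_eq0.
  have := hd (y - x); rewrite /= sub0r normrN => /(_ yd yx0).
  rewrite /g subrK => /ltW; rewrite -(ler_pM2r (_ : 0 < `|y - x|)) ?normr_gt0//.
  rewrite -normrM (_ : _ * (y - x) = - (f y - f x - derive1 f x * (y - x))).
    by rewrite normrN.
  by rewrite mulrBl opprB -[_ *: _]/(_ * _) mulrAC mulVf// mul1r.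
exists d => // p q /andP[px xq] qp.
have hp : `|p - x| = x - p by rewrite ler0_norm ?subr_le0// opprB.
have hq : `|q - x| = q - x by rewrite ger0_norm ?subr_ge0.
have := key q; have := key p; rewrite hp hq => /(_ ltac:(lra)) kp /(_ ltac:(lra)) kq.
rewrite (_ : f q - f p - derive1 f x * (q - p) =
  (f q - f x - derive1 f x * (q - x)) -
  (f p - f x - derive1 f x * (p - x))); last by ring.
apply: (le_trans (ler_normB _ _)); apply: (le_trans (lerD kq kp)).
by rewrite -mulrDr ler_pM2l//; lra.
Qed.

(** The largest multiple of [1/(n+1)] that does not exceed [x]. *)
Let mesh n x : R := (Num.floor (n.+1%:R * x))%:~R / n.+1%:R.

Let mesh_itv n x : mesh n x <= x <= mesh n x + n.+1%:R^-1.
Proof.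
have n0 : 0 < n.+1%:R :> R by rewrite ltr0n.
have /andP[h1 h2] := floor_itv (n.+1%:R * x).
rewrite /mesh; apply/andP; split; first by rewrite ler_pdivrMr// [x * _]mulrC.
rewrite (_ : _ + _ = ((Num.floor (n.+1%:R * x))%:~R + 1) / n.+1%:R).
  by rewrite ler_pdivlMr// [x * _]mulrC ltW// -[1]/(1%:~R) -intrD.
by rewrite mulrDl mul1r.
Qed.

(** The mesh takes one value per integer, each on an interval, so preimages are countable unions of
    intervals whatever [f] is. *)
Let measurable_mesh_comp n f :
  measurable_fun [set: measurableTypeR R] (fun x => f (mesh n x)).
Proof.
move=> _ Y mY; rewrite setTI.
pose E (z : int) : set R :=
  if f (z%:~R / n.+1%:R) \in Y then [set x | Num.floor (n.+1%:R * x) = z] else set0.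
rewrite (_ : _ @^-1` Y = \bigcup_z E z); last first.
  apply/seteqP; split => x /=.
    move=> Yx; exists (Num.floor (n.+1%:R * x)) => //.
    by rewrite /E mem_set.
  by move=> [z _]; rewrite /E; case: ifPn => //; rewrite inE /mesh => Yz /= ->.
apply: countable_bigcupT_measurable => [|z]; first exact: countableP.
rewrite /E; case: ifPn => // _; apply: is_interval_measurable => x y /= xz yz t.
move=> /andP[xt ty]; apply/eqP.
rewrite eq_le -[X in (_ <= X) && _]yz -[X in _ && (X <= _)]xz.
by rewrite !le_floor// ler_pM2l// ltr0n.
Qed.

(* Difference quotients over the mesh interval around x are step functions of x,
   hence Borel for an arbitrary T. *)
Lemma measurable_derive1_representative T :
  exists2 h, measurable_fun [set: measurableTypeR R] h &
    forall x, derivable T x 1 -> derive1 T x = h x.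
Proof.
pose D n x := n.+1%:R * (T (mesh n x + n.+1%:R^-1) - T (mesh n x)).
(* The upper limit exists at every point, including those where [T] is not differentiable, and is
   measurable; [fine] sends its infinite values to 0. *)
exists (fun x => fine (limn_esup (fun n => (D n x)%:E))).
  apply: measurableT_comp => //; apply: measurable_fun_limn_esup => n.
  apply/measurable_EFinP; apply: measurable_funM => //.
  apply: measurable_funB; last exact: measurable_mesh_comp.
  exact: (measurable_mesh_comp n (fun u => T (u + n.+1%:R^-1))).
move=> x Tx.
have DT : D n x @[n --> \oo] --> derive1 T x.
  apply/cvgrPdist_le => e e0; have [d d0 hd] := derivable_straddle Tx e0.
  have [N hN] : exists N : nat, N.+1%:R^-1 < d.
    exists (Num.truncn d^-1).
    by rewrite invf_plt ?posrE ?ltr0n//; exact: truncnS_gt.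
  exists N => // n /= Nn.
  have n0 : 0 < n.+1%:R :> R by rewrite ltr0n.
  have nd : n.+1%:R^-1 < d.
    by rewrite (le_lt_trans _ hN)// lef_pV2 ?posrE ?ltr0n// ler_nat ltnS.
  have := hd _ _ (mesh_itv n x).
  rewrite (_ : mesh n x + _ - _ = n.+1%:R^-1); last by rewrite addrAC subrr add0r.
  move=> /(_ nd); rewrite -(ler_pM2l n0) mulrCA divff ?gt_eqF// mulr1.
  rewrite -{1}(ger0_norm (ltW n0)) -normrM distrC.
  by rewrite mulrBr mulrCA divff ?gt_eqF// mulr1.
have /cvg_limn_einf_sup[_ ->//] : (D n x)%:E @[n --> \oo] --> (derive1 T x)%:E.
by apply/cvg_EFin => //; apply: nearW.
Qed.

Lemma locally_integrable_itv h : measurable_fun setT h ->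
  (forall u v : R, mu.-integrable `[u, v] (EFin \o h)) ->
  locally_integrable [set: R] h.
Proof.
move=> mh ih; split => //; first exact: openT.
move=> K _ /[dup] cK /compact_bounded[M [Mreal hM]].
have KM : K `<=` `[- (M + 1), M + 1].
  move=> x Kx /=; rewrite in_itv /= -ler_norml; apply: hM => //.
  by rewrite ltrDl.
have /integrableP[_] := ih (- (M + 1)) (M + 1).
apply: le_lt_trans; apply: ge0_subset_integral => //.
  exact: compact_measurable.
by apply/measurable_EFinP; apply: measurableT_comp => //; exact: measurable_funTS.
Qed.

Lemma primitive_ae h : measurable_fun [set: measurableTypeR R] h ->
  (forall u v : R, mu.-integrable `[u, v] (EFin \o h)) ->
  exists T, {ae mu, forall x, derivable T x 1 /\ derive1 T x = h x}.
Proof.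
move=> mh ih.
(* Restarting the primitive at each integer avoids signed intervals; T need only
   be differentiable almost everywhere. *)
exists (fun x => \int[mu]_(t in `[(Num.floor x)%:~R, x]) h t).
have cZ : countable (range (fun z : int => z%:~R : R)).
  exact: (sub_countable (card_image_le _ _) (countableP _)).
have Z0 : {ae mu, forall x, ~ range (fun z : int => z%:~R : R) x}.
  exists (range (fun z : int => z%:~R : R)); split.
  - exact: countable_measurable.
  - exact: countable_lebesgue_measure0.
  - by move=> x /= /contrapT.
have := lebesgue_differentiation (locally_integrable_itv mh ih).
move: Z0; apply: (@filterS2 _ _ (ae_filter_ringOfSetsType mu)).
move=> x xZ hx; set z := Num.floor x.
have /andP[] := floor_itv x; rewrite -/z le_eqVlt => /predU1P[zx|zx xz1].
  by exfalso; apply: xZ; exists z.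
have := @FTC1_lebesgue_pt _ h (BLeft z%:~R) x (x + 1) _ (ih _ _) _ hx.
have bx : ((z%:~R : R)%:E < x%:E)%E by rewrite lte_fin.
rewrite ltrDl => /(_ ltr01 bx) /= [dF FE].
(* Away from the integers [Num.floor] is locally constant, so the candidate coincides near [x] with
   the primitive started at [z], to which the fundamental theorem of calculus applies. *)
have near_eq : \forall y \near x,
  \int[mu]_(t in [set` Interval (BLeft z%:~R) (BRight y)]) h t =
  \int[mu]_(t in `[(Num.floor y)%:~R, y]) h t.
  near=> y.
  suff -> : Num.floor y = z by [].
  apply: floor_def; apply/andP; split; near: y.
    by near do apply: ltW; exact: lt_nbhsr.
  exact: lt_nbhsl.
split; first exact: near_eq_derivable dF.
by rewrite -FE !derive1E; apply/esym/near_eq_derive.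
Unshelve. all: by end_near. Qed.

End derivative_representatives.

(** * Integrated Legendre polynomials *)

Section integrated_legendre.
Variable R : realType.
Local Notation mu := (@lebesgue_measure R).

Let coeff n k : R := (-1) ^+ k * 'C(n, k)%:R ^+ 2.

Let shifted_legendreE n (t : R) : shifted_legendre n t =
  \sum_(k < n.+1) coeff n k * XMonemX (n - k) k t.
Proof. by apply: eq_bigr => k _; rewrite /XMonemX /coeff !mulrA. Qed.

Let integrable_term n (k : 'I_n.+1) : mu.-integrable `[0, 1]
  (fun t : R => (coeff n k * XMonemX (n - k) k t)%:E).
Proof.
rewrite (_ : (fun _ => _) =
    (fun t : R => (coeff n k)%:E * (EFin \o XMonemX (n - k) k) t)%E).
  by apply: integrableZl => //; exact: integrable_XMonemX.
by apply/funext => t; exact: EFinM.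
Qed.

Lemma integrable_shifted_legendre n :
  mu.-integrable `[0, 1] (EFin \o @shifted_legendre R n).
Proof.
rewrite (_ : _ \o _ = fun t : R =>
    (\sum_(k < n.+1) (coeff n k * XMonemX (n - k) k t)%:E)%E).
  by apply: integrable_sum => // k _; exact: integrable_term.
by apply/funext => t; rewrite /= shifted_legendreE sumEFin.
Qed.

(** By the beta integral, the term of index [k] contributes [(-1)^k 'C(n, k)] up to the common
    factor [n! / (n+1)!], and the alternating sum of binomials is [(1 - 1)^n]. *)
Lemma integral_shifted_legendre n : (0 < n)%N ->
  \int[mu]_(t in `[0, 1]) shifted_legendre n t = 0.
Proof.
move=> n0; rewrite /Rintegral.
under eq_integral do rewrite shifted_legendreE -sumEFin.
rewrite integral_sum//.
have -> : (\sum_(k < n.+1) \int[mu]_(t in `[0%R, 1%R])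
    (coeff n k * XMonemX (n - k) k t)%:E)%E =
  ((n`!%:R / n.+1`!%:R) * \sum_(k < n.+1) ((-1) ^+ k * 'C(n, k)%:R))%:E :> \bar R.
  rewrite mulr_sumr -sumEFin; apply: eq_bigr => k _.
  have kn : (k <= n)%N by rewrite -ltnS.
  rewrite -[LHS]fineK; last exact: (integrable_fin_num _ (integrable_term k)).
  rewrite -/(Rintegral _ _ _) RintegralZl//; last exact: integrable_XMonemX.
  rewrite Rintegral_mkcond -[\int[_]_x _]/(beta_fun (n - k).+1 k.+1).
  rewrite beta_fun_fact subnK// /coeff; congr _%:E.
  have -> : n`! = ('C(n, k) * ((n - k)`! * k`!))%N.
    by rewrite [((_)`! * _)%N]mulnC bin_fact.
  rewrite !natrM; ring.
rewrite /= (_ : \sum_(k < n.+1) _ = 0) ?mulr0//.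
transitivity ((1 - 1 : R) ^+ n); last by rewrite subrr expr0n gtn_eqF.
by rewrite exprBn; apply: eq_bigr => k _; rewrite !expr1n !mulr1 mulr_natr.
Qed.

Lemma Kfun0 r : Kfun r (0 : R) = 0.
Proof. by rewrite /Kfun set_itv1 Rintegral_set1. Qed.

Lemma Kfun1 r : (2 <= r)%N -> Kfun r (1 : R) = 0.
Proof. by case: r => [//|r] r1; exact: integral_shifted_legendre. Qed.

Lemma measurable_Kfun r : measurable_fun (open01 R) (@Kfun R r).
Proof.
have /= := parameterized_integral_continuous (@ler01 R)
  (integrable_shifted_legendre r.-1).
move=> /subspace_continuous_measurable_fun => /(_ (measurable_itv _)).
apply: measurable_funS => // x /= /andP[x0 x1].
by rewrite in_itv /= !ltW.
Qed.

End integrated_legendre.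

(** * From signed measures to functions *)

Section quantile_change_of_variables.
Local Open Scope ereal_scope.
Variables (R : realType) (F : cumulativeBounded (0%R : R) (1%R : R)).
Variable Q : {sigma_finite_measure set (measurableTypeR R) -> \bar R}.
Hypothesis QF : quantile_measure F Q.
Local Notation mu := (@lebesgue_measure R).
Local Notation X := (open01 R).
Local Notation D := (F @^-1` (open01 R)).

Let mF := measurable_cumulative F.
Let mX : measurable X. Proof. exact: measurable_open01. Qed.

Lemma measurable_preimage_cumulative (A : set (measurableTypeR R)) :
  measurable A -> measurable (F @^-1` A : set (measurableTypeR R)).
Proof. by move=> mA; rewrite -[X in measurable X]setTI; exact: mF. Qed.

Let mD : measurable (D : set (measurableTypeR R)).
Proof. exact: measurable_preimage_cumulative. Qed.

Section integral.
Variables (A : set (measurableTypeR R)) (k : measurableTypeR R -> \bar R).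
Hypotheses (mA : measurable A) (mk : measurable_fun A k).

Lemma ge0_integral_quantile : (forall u, A u -> 0 <= k u) ->
  \int[Q]_(u in A) k u = \int[mu]_(x in F @^-1` A `&` D) k (F x).
Proof.
move=> k0.
have QE B : measurable B ->
    Q B = \int[mu]_(x in F @^-1` B `&` D) ((cst 1%R : R -> R) x)%:E.
  move=> mB; rewrite (quantile_measureE QF)//.
  have mBD : measurable (F @^-1` B `&` D : set (measurableTypeR R)).
    by apply: measurableI => //; exact: measurable_preimage_cumulative.
  have := integral_cst mu mBD 1; rewrite mul1e => <-.
  exact: eq_integral.
rewrite (integral_weighted_pushforward mF mD _ _ QE)//.
by apply: eq_integral => x _; rewrite mule1.
Qed.

Lemma measurable_comp_cumulative :
  measurable_fun (F @^-1` A `&` D) (fun x : measurableTypeR R => k (F x)).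
Proof.
apply: (measurable_comp mA _ mk); first by move=> _ [x [? _] <-].
exact: measurable_funTS.
Qed.

End integral.

Lemma integral_quantile (A : set (measurableTypeR R))
    (k : measurableTypeR R -> \bar R) :
  measurable A -> measurable_fun A k ->
  \int[Q]_(u in A) k u = \int[mu]_(x in F @^-1` A `&` D) k (F x).
Proof.
move=> mA mk; rewrite integralE [RHS]integralE; congr (_ - _);
  rewrite ge0_integral_quantile//.
- by apply: eq_integral => x _; rewrite !funeposE.
- exact: measurable_funepos.
- by apply: eq_integral => x _; rewrite !funenegE.
- exact: measurable_funeneg.
Qed.

Lemma integrable_quantile (A : set (measurableTypeR R))
    (k : measurableTypeR R -> \bar R) :
  measurable A -> measurable_fun A k ->
  Q.-integrable A k <-> mu.-integrable (F @^-1` A `&` D) (fun x => k (F x)).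
Proof.
move=> mA mk.
have e : \int[Q]_(u in A) `|k u| = \int[mu]_(x in F @^-1` A `&` D) `|k (F x)|.
  by rewrite ge0_integral_quantile//; exact: measurableT_comp.
split => /integrableP[_ h]; apply/integrableP; split => //.
- exact: measurable_comp_cumulative.
- by rewrite -e.
- by rewrite e.
Qed.

Lemma cumulative_ge0_le1 x : (0 <= F x <= 1)%R.
Proof.
apply/andP; split; rewrite leNgt; apply/negP => Fx.
  have [m [_ hm]] : \forall y \near -oo%R, (F x < F y)%R.
    by apply: (cvgr_gt _ (cumulativeNy F)).
  have ym : (Num.min x m - 1 < m)%R by rewrite ltrBlDr ltr_pwDr// ge_min lexx orbT.
  have yx : (Num.min x m - 1 <= x)%R by rewrite lerBlDr ler_wpDr// ge_min lexx.
  have := hm _ ym; rewrite ltNge => /negP; apply.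
  exact: cumulative_is_nondecreasing.
have [m [_ hm]] : \forall y \near +oo%R, (F y < F x)%R.
  by apply: (cvgr_lt _ (cumulativey F)).
have ym : (m < Num.max x m + 1)%R by rewrite ltr_pwDr// le_max lexx orbT.
have yx : (x <= Num.max x m + 1)%R by rewrite ler_wpDr// le_max lexx.
have := hm _ ym; rewrite ltNge => /negP; apply.
exact: cumulative_is_nondecreasing.
Qed.

Lemma Kfun_cumulative_eq0 r x : (2 <= r)%N -> ~ D x -> Kfun r (F x) = 0%R.
Proof.
move=> r2; rewrite /open01 /= => Dx; have /andP[F0 F1] := cumulative_ge0_le1 x.
move: F0; rewrite le_eqVlt => /predU1P[<-|F0]; first exact: Kfun0.
move: F1; rewrite le_eqVlt => /predU1P[->|F1]; first exact: Kfun1.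
by exfalso; apply: Dx; rewrite F0.
Qed.

End quantile_change_of_variables.

(** * Integrability drawn from a finite divergence *)

Section divergence_integrability.
Local Open Scope ereal_scope.
Variables (R : realType) (phi : R -> \bar R) (a b : \bar R).
Hypothesis phi_ge0 : forall x, 0 <= phi x.
Hypothesis phi_convex : strictly_convex phi.
Hypothesis phi1 : phi 1%R = 0.
Hypothesis phi_dom : [set x | phi x < +oo] = [set x | a < x%:E < b].
Hypothesis ab1 : a < 1 < b.
Local Notation mu := (@lebesgue_measure R).

Variable h : R -> R.
Hypothesis mh : measurable_fun [set: measurableTypeR R] h.
Hypothesis phih : \int[mu]_x phi (h x) < +oo.

Let mphi : measurable_fun setT phi.
Proof. exact: (measurable_divergence phi_ge0 phi_convex phi_dom). Qed.

Let mphih (A : set (measurableTypeR R)) : measurable_fun A (phi \o h).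
Proof. by apply: measurable_funTS; exact: measurableT_comp. Qed.

Let phihA (A : set (measurableTypeR R)) : measurable A ->
  \int[mu]_(x in A) phi (h x) < +oo.
Proof.
by move=> mA; apply: le_lt_trans phih; apply: ge0_subset_integral => //; exact: mphih.
Qed.

(** The bound [C (1 + phi z)] on [|z|] has a constant term, which contributes [C] times the measure
    of [A]: hence the finiteness assumption. *)
Lemma divergence_locally_integrable (A : set (measurableTypeR R)) :
  measurable A -> mu A < +oo -> mu.-integrable A (EFin \o h).
Proof.
move=> mA Afin.
have [C C0 hC] := divergence_growth phi_ge0 phi_convex phi1 phi_dom ab1.
apply/integrableP; split; first by apply/measurable_EFinP; exact: measurable_funTS.
apply: (@le_lt_trans _ _ (\int[mu]_(x in A) (C%:E * (1 + phi (h x))))).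
  apply: ge0_le_integral => //.
  - by apply: measurableT_comp => //; apply/measurable_EFinP; exact: measurable_funTS.
  - apply: emeasurable_funM; first exact: measurable_cst.
    by apply: emeasurable_funD; [exact: measurable_cst|exact: mphih].
  - by move=> x _; have [] := hC (h x).
rewrite ge0_integralZl//; last 3 first.
- by apply: emeasurable_funD; [exact: measurable_cst|exact: mphih].
- by move=> x _; rewrite adde_ge0.
- by rewrite lee_fin ltW.
rewrite lte_mul_pinfty ?lee_fin ?(ltW C0)// ge0_integralD//.
by rewrite integral_cst// mul1e lte_add_pinfty// phihA.
Qed.

(** The bound on [- z] has no constant term and can be integrated over the whole line. *)
Lemma divergence_funrneg_integrable : mu.-integrable setT (EFin \o h^\-%R).
Proof.
have [C C0 hC] := divergence_growth phi_ge0 phi_convex phi1 phi_dom ab1.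
have mhn : measurable_fun [set: measurableTypeR R] h^\-%R.
  exact: measurable_funrneg.
apply/integrableP; split; first exact/measurable_EFinP.
apply: (@le_lt_trans _ _ (\int[mu]_x (C%:E * phi (h x)))).
  apply: ge0_le_integral => //.
  - by apply: measurableT_comp => //; exact/measurable_EFinP.
  - by apply: emeasurable_funM; [exact: measurable_cst|exact: mphih].
  - move=> x _; have [_ hx] := hC (h x).
    rewrite /comp gee0_abs ?lee_fin ?funrneg_ge0// /funrneg EFin_max ge_max hx/=.
    by rewrite mule_ge0// lee_fin ltW.
rewrite ge0_integralZl//; last by rewrite lee_fin ltW.
by rewrite lte_mul_pinfty ?lee_fin ?(ltW C0).
Qed.

End divergence_integrability.

Section quantile_to_function.
Local Open Scope ereal_scope.
Variables (R : realType) (phi : R -> \bar R) (a b : \bar R).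
Hypothesis phi_ge0 : forall x, 0 <= phi x.
Hypothesis phi_convex : strictly_convex phi.
Hypothesis phi1 : phi 1%R = 0.
Hypothesis phi_dom : [set x | phi x < +oo] = [set x | a < x%:E < b].
Hypothesis ab1 : a < 1 < b.
Variables (F : cumulativeBounded (0%R : R) (1%R : R)).
Variable Q : {sigma_finite_measure set (measurableTypeR R) -> \bar R}.
Hypothesis QF : quantile_measure F Q.
Variables (l : nat) (i : 'I_l -> nat) (c : 'cV[R]_l).
Hypothesis i_ge2 : forall j, (2 <= i j)%N.
Local Notation mu := (@lebesgue_measure R).
Local Notation X := (open01 R).
Local Notation D := (F @^-1` (open01 R)).

Let mX : measurable X. Proof. exact: measurable_open01. Qed.
Let mD : measurable (D : set (measurableTypeR R)).
Proof. exact: measurable_preimage_cumulative. Qed.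
Let mF := measurable_cumulative F.

(** [density] falls back on a dummy value when there is no version; the signed Radon-Nikodym theorem
    excludes this case. *)
Lemma density_is_density G : L_class i Q c G -> is_density G Q (density G Q).
Proof.
move=> [sG GQ _ _]; have [g gG] := signed_radon_nikodym sG GQ.
exact: (@xgetPex _ (cst 0%R) [set g | is_density G Q g] (ex_intro _ g gG)).
Qed.

Lemma quantile_to_function G : L_class i Q c G ->
  \int[Q]_(u in X) phi (density G Q u) < +oo ->
  exists2 T, L''_class i F c T &
    \int[completed_lebesgue_measure]_x phi (derive1 T x) =
    \int[Q]_(u in X) phi (density G Q u).
Proof.
move=> LG; have gG := density_is_density LG; set g := density G Q in gG *.
have mg : measurable_fun setT g by case: gG.
have mphi := measurable_divergence phi_ge0 phi_convex phi_dom.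
have mphig A : measurable_fun A (fun u => phi (g u)).
  by apply: measurable_funTS; exact: measurableT_comp.
(* The value 1 off [D] is the zero of [phi], so no divergence is added there. *)
pose h x := (\1_D x * g (F x) + \1_(~` D) x)%R.
have hD x : D x -> h x = g (F x).
  by move=> Dx; rewrite /h !indicE mem_set// memNset ?mul1r ?addr0//; exact.
have hND x : ~ D x -> h x = 1%R.
  by move=> Dx; rewrite /h !indicE memNset// mem_set// mul0r add0r.
have mh : measurable_fun [set: measurableTypeR R] h.
  apply: measurable_funD.
    apply: measurable_funM; first exact: measurable_indic.
    exact: (measurableT_comp mg mF).
  by apply: measurable_indic; exact: measurableC.
have phih : \int[mu]_x phi (h x) = \int[Q]_(u in X) phi (g u).
  rewrite (integral_quantile QF mX)// setIid [RHS]integral_mkcond.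
  apply: eq_integral => x _; rewrite patchE; case: ifPn.
    by rewrite inE => /hD ->.
  by rewrite notin_setE => /hND ->.
rewrite -phih => phih_fin.
have ih u v : mu.-integrable `[u, v] (EFin \o h).
  apply: (divergence_locally_integrable phi_ge0 phi_convex phi1 phi_dom ab1) => //.
  by rewrite lebesgue_measure_itv /=; case: ifPn => _; rewrite -?EFinB ltry.
have [T hT] := primitive_ae mh ih.
have T'h : {ae @completed_lebesgue_measure R, forall x, h x = derive1 T x}.
  apply: ae_completed; case: hT => N [mN N0 sN]; exists N; split => // x /= hx.
  by apply: sN => /= -[_ /esym].
have mK j : measurable_fun X (fun u => (Kfun (i j) u * g u)%:E).
  apply/measurable_EFinP; apply: measurable_funM; first exact: measurable_Kfun.
  exact: measurable_funTS.
have KhE j : (fun x => (Kfun (i j) (F x) * h x)%:E) =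
    (fun x => (Kfun (i j) (F x) * g (F x))%:E) \_ D.
  apply/funext => x; rewrite patchE; case: ifPn.
    by rewrite inE => /hD ->.
  by rewrite notin_setE => /Kfun_cumulative_eq0 ->//; rewrite mul0r.
have mKF j : measurable_fun (D : set (measurableTypeR R))
    (fun x => (Kfun (i j) (F x) * g (F x))%:E).
  have := measurable_comp_cumulative (F := F) mX (mK j).
  by rewrite setIid.
have mKh j : measurable_fun [set: measurableTypeR R]
    (fun x => (Kfun (i j) (F x) * h x)%:E).
  rewrite KhE.
  have h1 := proj1 (@measurable_restrictT _ _ (measurableTypeR R) _ D
    (fun x => (Kfun (i j) (F x) * g (F x))%:E) mD).
  have h2 := h1 (mKF j).
  exact: h2.
have KT j : {ae @completed_lebesgue_measure R, forall x,
    (Kfun (i j) (F x) * h x)%:E = (Kfun (i j) (F x) * derive1 T x)%:E}.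
  case: T'h => N [mN N0 sN]; exists N; split => // x /= hx.
  by apply: sN => /= hxE; apply: hx; rewrite hxE.
have [_ _ iG cG] := LG.
have iKg j : Q.-integrable X (fun u => (Kfun (i j) u * g u)%:E).
  by have /(signed_integrable_density gG _ mX)[] := iG j.
exists T; last first.
  rewrite (ae_integral_completed (f := fun x => phi (h x)))//.
    exact: (measurableT_comp mphi mh).
  case: T'h => N [mN N0 sN]; exists N; split => // x /= hx.
  by apply: sN => /= hxE; apply: hx; rewrite hxE.
split.
- apply: ae_completed; case: hT => N [mN N0 sN]; exists N; split => // x /= hx.
  by apply: sN => /= -[].
- move=> j; apply/(ae_integrable_completed (mKh j) (KT j)).
  rewrite KhE -integrable_mkcond//.
  by have /(integrable_quantile QF mX (mK j)) := iKg j; rewrite setIid.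
- rewrite -cG; apply/colP => j; rewrite !mxE.
  rewrite (signed_integral_density gG)//; last exact: measurable_Kfun.
  rewrite /Rintegral (ae_integral_completed (mKh j) (KT j)) KhE.
  by rewrite -integral_mkcond (integral_quantile QF mX (mK j)) setIid.
Qed.

End quantile_to_function.

(** * From functions to signed measures *)

Section density_signed_measure.
Local Open Scope ereal_scope.
Context d (T : measurableType d) (R : realType) (Q : {measure set T -> \bar R}).
Variable g : T -> R.
Hypothesis mg : measurable_fun setT g.
Hypothesis ign : Q.-integrable setT (EFin \o g^\-%R).

Let nfin A : measurable A -> \int[Q]_(x in A) (g^\- x)%:E \is a fin_num.
Proof.
by move=> mA; apply: integrable_fin_num => //; exact: integrableS ign.
Qed.

Let GE A : \int[Q]_(x in A) (g x)%:E =
  \int[Q]_(x in A) (g^\+ x)%:E - \int[Q]_(x in A) (g^\- x)%:E.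
Proof.
by rewrite integralE -[(fun x => (g x)%:E)]/(EFin \o g) funerpos funerneg.
Qed.

(** Integrability of the negative part excludes the value [-oo] and allows the two nonnegative
    series to be subtracted in the limit. *)
Lemma signed_measure_of_density :
  signed_measure (fun A => \int[Q]_(x in A) (g x)%:E).
Proof.
have mgp : measurable_fun setT (EFin \o g^\+%R).
  by apply/measurable_EFinP; exact: measurable_funrpos.
have mgn : measurable_fun setT (EFin \o g^\-%R).
  by apply/measurable_EFinP; exact: measurable_funrneg.
split; first by rewrite integral_set0.
  left => A mA; rewrite GE; have := nfin mA.
  have : 0 <= \int[Q]_(x in A) (g^\+ x)%:E.
    by apply: integral_ge0 => x _; rewrite lee_fin funrpos_ge0.
  by case: (\int[Q]_(x in A) (g^\+ x)%:E) => [r| |]//; case: (\int[Q]_(x in A) _).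
move=> /= B mB tB mUB; rewrite [X in X @ _ --> _](_ : _ = fun n =>
    \sum_(0 <= i < n) (\int[Q]_(x in B i) (g^\+ x)%:E) -
    \sum_(0 <= i < n) (\int[Q]_(x in B i) (g^\- x)%:E)); last first.
  apply/funext => n; under eq_bigr do rewrite GE.
  rewrite big_split/= sumeN//= => i j _ _.
  by rewrite fin_num_adde_defl// nfin.
rewrite GE; apply: cvgeD.
- by rewrite fin_num_adde_defl// fin_numN nfin.
- apply: semi_sigma_additive_nng_induced => // x.
  by rewrite lee_fin funrpos_ge0.
- apply/cvgeN/semi_sigma_additive_nng_induced => // x.
  by rewrite lee_fin funrneg_ge0.
Qed.

End density_signed_measure.

(** * Conditional expectation given the cdf *)

Section conditional_density.
Local Open Scope ereal_scope.
Variables (R : realType) (F : cumulativeBounded (0%R : R) (1%R : R)).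
Variable Q : {sigma_finite_measure set (measurableTypeR R) -> \bar R}.
Hypothesis QF : quantile_measure F Q.
Local Notation mu := (@lebesgue_measure R).
Local Notation X := (open01 R).
Local Notation D := (F @^-1` (open01 R)).
Local Notation fiber A := (F @^-1` A `&` (F @^-1` (open01 R))).

Let mX : measurable X. Proof. exact: measurable_open01. Qed.
Let mD : measurable (D : set (measurableTypeR R)).
Proof. exact: measurable_preimage_cumulative. Qed.
Let mF := measurable_cumulative F.

Lemma measurable_fiber (A : set (measurableTypeR R)) : measurable A ->
  measurable (fiber A : set (measurableTypeR R)).
Proof.
by move=> mA; apply: measurableI => //; exact: measurable_preimage_cumulative.
Qed.

Lemma fiber_open01_exhaustion n :
  fiber (@open01_exhaustion R n) = F @^-1` (@open01_exhaustion R n).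
Proof.
by apply/setIidl => x /= Fx; rewrite -bigcup_open01_exhaustion; exists n.
Qed.

(** The image [nu] under [F] of the measure with density [f] on [D] is dominated by [Q], the image
    of Lebesgue measure, and is finite on the exhaustion. Its Radon-Nikodym density is the
    conditional expectation, characterised here by test functions [k] so that it can be integrated
    against [K] and against slopes. *)
Lemma ge0_conditional_density (f : R -> R) :
  measurable_fun [set: measurableTypeR R] f -> (forall x, (0 <= f x)%R) ->
  (forall n, \int[mu]_(x in fiber (@open01_exhaustion R n)) (f x)%:E < +oo) ->
  exists g : measurableTypeR R -> R, [/\ measurable_fun setT g,
    forall u, (0 <= g u)%R &
    forall A k, measurable A -> measurable_fun A k -> (forall u, A u -> 0 <= k u) ->
    \int[Q]_(u in A) (k u * (g u)%:E) =
    \int[mu]_(x in fiber A) (k (F x) * (f x)%:E)].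
Proof.
move=> mf f0 flty.
pose nu A := \int[mu]_(x in fiber A) (f x)%:E.
have nu0 A : 0 <= nu A by apply: integral_ge0 => x _; rewrite lee_fin.
have [m mE] := weighted_pushforward_measure mF mD mf f0 nu0 (fun A _ => erefl).
have nuX A : A `<=` ~` X -> nu A = 0.
  move=> AX; rewrite /nu (_ : fiber A = set0) ?integral_set0// -subset0.
  by move=> x [/AX].
have nuQ : nu `<< Q.
  rewrite -mE; apply/null_content_dominatesP => A mA QA; rewrite mE /nu.
  apply: null_set_integral; first exact: measurable_fiber.
    by apply/measurable_EFinP; exact: measurable_funTS.
  by have := quantile_measureE QF mA; rewrite QA => /esym.
have sm : sigma_finite_signed_measure_on X nu.
  split.
  - split.
    + by rewrite -mE measure0.
    + by left => A mA; rewrite gt_eqF// (lt_le_trans _ (nu0 _)).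
    + by rewrite -mE; exact: measure_semi_sigma_additive.
  - by move=> A _; exact: nuX.
  - exists (@open01_exhaustion R); first by rewrite bigcup_open01_exhaustion.
    move=> n; split; first exact: measurable_open01_exhaustion.
    by rewrite ge0_fin_numE//; exact: flty.
have [g0 g0E] := signed_radon_nikodym sm nuQ.
have mg0 : measurable_fun setT g0 by case: g0E.
have mgp : measurable_fun setT g0^\+%R by exact: measurable_funrpos.
(* The Radon-Nikodym density may be negative on a null set. Its positive part is also a density,
   because a positive measure equals its own positive variation. *)
exists g0^\+%R; split => // A k mA mk k0.
have mid : measurable_fun setT (@id (measurableTypeR R)) by exact: measurable_id.
have mQ B : measurable B -> m B = \int[Q]_(u in id @^-1` B `&` setT) (g0^\+ u)%:E.
  move=> mB; rewrite setIT -(positive_variationE g0E)// mE; apply/eqP.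
  rewrite eq_le; apply/andP; split.
    by apply: ereal_sup_ubound; exists B => //; split.
  apply: ge_ereal_sup => _ [C [mC CB] <-].
  by rewrite -mE; apply: le_measure; rewrite ?inE.
have mmu B : measurable B -> m B = \int[mu]_(x in F @^-1` B `&` D) (f x)%:E.
  by move=> mB; rewrite mE.
have := integral_weighted_pushforward mid measurableT mgp (funrpos_ge0 g0) mQ mA mk k0.
rewrite setIT => <-.
exact: (integral_weighted_pushforward mF mD mf f0 mmu mA mk k0).
Qed.

Lemma conditional_density_Rintegral (f : R -> R) (g : measurableTypeR R -> R) A
    (k : measurableTypeR R -> R) :
  measurable_fun [set: measurableTypeR R] f -> (forall x, (0 <= f x)%R) ->
  measurable_fun setT g -> (forall u, (0 <= g u)%R) ->
  (forall A k, measurable A -> measurable_fun A k -> (forall u, A u -> 0 <= k u) ->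
    \int[Q]_(u in A) (k u * (g u)%:E) =
    \int[mu]_(x in fiber A) (k (F x) * (f x)%:E)) ->
  measurable A -> measurable_fun A k ->
  mu.-integrable (fiber A) (fun x => (k (F x) * f x)%:E) ->
  Q.-integrable A (fun u => (k u * g u)%:E) /\
  \int[Q]_(u in A) (k u * g u)%:E = \int[mu]_(x in fiber A) (k (F x) * f x)%:E.
Proof.
move=> mf f0 mg g0 gE mA mk ikf.
have mkE : measurable_fun A (EFin \o k) by exact/measurable_EFinP.
have posE (S : Type) (v w : S -> R) : (forall x, (0 <= w x)%R) ->
    (fun x => (v x * w x)%:E)^\+ = (fun x => (EFin \o v)^\+ x * (w x)%:E).
  move=> w0; apply/funext => x; rewrite !funeposE /=.
  by rewrite maxe_pMl ?lee_fin// mul0e.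
have negE (S : Type) (v w : S -> R) : (forall x, (0 <= w x)%R) ->
    (fun x => (v x * w x)%:E)^\- = (fun x => (EFin \o v)^\- x * (w x)%:E).
  move=> w0; apply/funext => x; rewrite !funenegE /=.
  by rewrite maxe_pMl ?lee_fin// mul0e -EFinM mulNr.
split.
  apply/integrableP; split.
    apply/measurable_EFinP/measurable_funM => //; exact: measurable_funTS.
  move/integrableP : ikf => [_]; apply: le_lt_trans.
  under eq_integral do rewrite EFinM abseM [X in _ * X]gee0_abs ?lee_fin//.
  rewrite (gE A (fun u => `|(k u)%:E|))//; last exact: measurableT_comp.
  rewrite le_eqVlt; apply/orP; left; apply/eqP; apply: eq_integral => x _.
  by rewrite [in RHS]EFinM abseM [X in _ = _ * X]gee0_abs ?lee_fin.
rewrite integralE [RHS]integralE !posE// !negE//; congr (_ - _); rewrite gE//.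
- by apply: eq_integral => x _; rewrite !funeposE.
- exact: measurable_funepos.
- by apply: eq_integral => x _; rewrite !funenegE.
- exact: measurable_funeneg.
Qed.

End conditional_density.

(** * Jensen's inequality for the conditional expectation *)

Section conditional_jensen.
Local Open Scope ereal_scope.
Variables (R : realType) (phi : R -> \bar R) (a b : \bar R).
Hypothesis phi_ge0 : forall x, 0 <= phi x.
Hypothesis phi_convex : strictly_convex phi.
Hypothesis phi1 : phi 1%R = 0.
Hypothesis phi_dom : [set x | phi x < +oo] = [set x | a < x%:E < b].
Hypothesis ab1 : a < 1 < b.
Variables (F : cumulativeBounded (0%R : R) (1%R : R)).
Variable Q : {sigma_finite_measure set (measurableTypeR R) -> \bar R}.
Hypothesis QF : quantile_measure F Q.
Local Notation mu := (@lebesgue_measure R).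
Local Notation X := (open01 R).
Local Notation fiber A := (F @^-1` A `&` (F @^-1` (open01 R))).
Variables (h : R -> R) (g : measurableTypeR R -> R).
Hypothesis mh : measurable_fun [set: measurableTypeR R] h.
Hypothesis mg : measurable_fun setT g.
Hypothesis phih : \int[mu]_x phi (h x) < +oo.
Hypothesis hg : forall A (k : measurableTypeR R -> R),
  measurable A -> measurable_fun A k ->
  mu.-integrable (fiber A) (fun x => (k (F x) * h x)%:E) ->
  mu.-integrable (fiber A) (fun x => (k (F x) * g (F x))%:E) /\
  \int[mu]_(x in fiber A) (k (F x) * g (F x))%:E =
  \int[mu]_(x in fiber A) (k (F x) * h x)%:E.

Let mX : measurable X. Proof. exact: measurable_open01. Qed.
Let mF := measurable_cumulative F.
Let mI n : measurable (@open01_exhaustion R n).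
Proof. exact: measurable_open01_exhaustion. Qed.
Let mphi : measurable_fun setT phi.
Proof. exact: (measurable_divergence phi_ge0 phi_convex phi_dom). Qed.
Let mphih (A : set (measurableTypeR R)) : measurable_fun A (fun x => phi (h x)).
Proof. by apply: measurable_funTS; exact: (measurableT_comp mphi mh). Qed.

Let dom x : (phi x < +oo) = (a < x%:E < b).
Proof. by move/seteqP : phi_dom => [h1 h2]; apply/idP/idP => [/h1|/h2]. Qed.

Let mdom : measurable [set u | a < (g u)%:E < b].
Proof.
rewrite (_ : mkset _ = g @^-1` [set x | a < x%:E < b])//.
rewrite -[X in measurable X]setTI; apply: mg => //.
apply: is_interval_measurable => x y /= /andP[ax xb] /andP[ay yb] z /andP[xz zy].
by rewrite (lt_le_trans ax) ?lee_fin//= (le_lt_trans _ yb) ?lee_fin.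
Qed.

(** This supplies the integrability required by [hg]: a piece of the exhaustion has a preimage of
    finite measure, on which [h] is integrable by the growth of [phi]. *)
Let bounded_integrable A n (k : measurableTypeR R -> R) (M : R) : measurable A ->
  A `<=` @open01_exhaustion R n -> measurable_fun A k ->
  (forall u, A u -> (`|k u| <= M)%R) ->
  mu.-integrable (fiber A) (fun x => (k (F x) * h x)%:E).
Proof.
move=> mA AI mk kM.
have mfA : measurable (fiber A : set (measurableTypeR R)) by exact: measurable_fiber.
have fAlty : mu (fiber A) < +oo.
  apply: le_lt_trans (lebesgue_preimage_open01_exhaustion F n).
  apply: le_measure; rewrite ?inE//.
    exact: measurable_preimage_cumulative.
  by move=> x [/AI].
have ih : mu.-integrable (fiber A) (EFin \o h).
  exact: (divergence_locally_integrable phi_ge0 phi_convex phi1 phi_dom ab1).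
have mkF : measurable_fun (fiber A : set (measurableTypeR R)) (fun x => k (F x)).
  apply: (measurable_comp mA _ mk); first by move=> _ [x [? _] <-].
  exact: measurable_funTS.
apply: (le_integrable _ _ _ (integrableZl _ M ih)) => //.
  by apply/measurable_EFinP/measurable_funM => //; exact: measurable_funTS.
move=> x [Ax _] /=; rewrite lee_fin !normrM ler_wpM2r//.
by rewrite (le_trans (kM _ Ax))// ler_norm.
Qed.

Let ae_dom : mu.-negligible [set x | ~~ (a < (h x)%:E < b)].
Proof.
have : mu.-integrable setT (fun x => phi (h x)).
  apply/integrableP; split; first exact: mphih.
  by under eq_integral do rewrite gee0_abs//.
move=> /integrable_ae => /(_ measurableT) [N [mN N0 sN]]; exists N; split => //.
move=> x /= hx; apply: sN => /= /(_ I); rewrite ge0_fin_numE// dom.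
by rewrite (negbTE hx).
Qed.

(* Were g <= a or g >= b on a set of positive measure, h - g \o F would have a
   constant sign and mean zero on its preimage. *)
Lemma conditional_mean_dom : Q.-negligible (X `&` [set u | ~~ (a < (g u)%:E < b)]).
Proof.
pose B n := @open01_exhaustion R n `&` ~` [set u | a < (g u)%:E < b].
have mB n : measurable (B n) by apply: measurableI => //; exact: measurableC.
have mle : measurable [set u | (g u)%:E <= a].
  rewrite -[X in measurable X]setTI; apply: emeasurable_fun_le => //.
  exact/measurable_EFinP.
(* The sign is 1 where [g <= a], and -1 elsewhere, which on [B n] means [g >= b]. As [h] lies
   strictly between [a] and [b] almost everywhere, [s * (h - g)] is positive in both cases. *)
pose s : measurableTypeR R -> R :=
  (fun u => 2 * \1_[set u | ((g u)%:E <= a)%E] u - 1)%R.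
have ms : measurable_fun setT s.
  apply: measurable_funB; last exact: measurable_cst.
  by apply: measurable_funM; [exact: measurable_cst|exact: measurable_indic].
have s1 u : (g u)%:E <= a -> s u = 1%R.
  by move=> ga; rewrite /s indicE mem_set// mulr1 (_ : 2 = 1 + 1)%R ?addrK.
have sN1 u : ~ ((g u)%:E <= a) -> s u = (-1)%R.
  by move=> ga; rewrite /s indicE memNset// mulr0 sub0r.
have sn u : (`|s u| <= 1)%R.
  case: (boolP ((g u)%:E <= a)) => [/s1 ->|/negP/sN1 ->]; first by rewrite normr1.
  by rewrite normrN1.
suff B0 n : Q (B n) = 0.
  exists (\bigcup_n B n); split.
  - exact: bigcup_measurable.
  - apply/eqP; rewrite -measure_le0.
    apply: le_trans (measure_sigma_subadditive _ _ _ _) _.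
    + exact: mB.
    + exact: bigcup_measurable.
    + exact: subset_refl.
    by rewrite eseries0// => n _ _; exact: B0.
  - move=> u [Xu /= /negP gu]; rewrite -setI_bigcupl bigcup_open01_exhaustion.
    by split.
have mfB : measurable (fiber (B n) : set (measurableTypeR R)).
  exact: measurable_fiber.
rewrite (quantile_measureE QF)//.
have ish := bounded_integrable (mB n) (@subIsetl _ _ _)
  (measurable_funTS ms) (fun u _ => sn u).
have [isg sgE] := hg (mB n) (measurable_funTS ms) ish.
pose psi x := (s (F x) * h x - s (F x) * g (F x))%R.
have ipsi : mu.-integrable (fiber (B n)) (EFin \o psi).
  exact: (integrableB mfB ish isg).
have psi0 : \int[mu]_(x in fiber (B n)) (psi x)%:E = 0.
  have := integralB mfB ish isg; rewrite sgE subee; last first.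
    exact: integrable_fin_num.
  by [].
have [N [mN N0 sN]] := ae_dom.
have psi_gt0 x : fiber (B n) x -> ~ N x -> (0 < psi x)%R.
  move=> [[_ /negP gB] _] Nx; have : (a < (h x)%:E < b).
    by apply: contrapT => /negP hx; apply: Nx; exact: sN.
  move=> /andP[ah hb]; rewrite /psi -mulrBr.
  case: (boolP ((g (F x))%:E <= a)) => [ga|ga].
    by rewrite s1// mul1r subr_gt0 -lte_fin (le_lt_trans ga).
  rewrite sN1; last exact/negP.
  rewrite mulN1r opprB subr_gt0 -lte_fin (lt_le_trans hb)//.
  by move: gB; rewrite -ltNge in ga; rewrite ga/= -leNgt.
have psiabs0 : \int[mu]_(x in fiber (B n)) `|(psi x)%:E| = 0.
  rewrite -psi0; apply: ae_eq_integral => //.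
  - by apply: measurableT_comp => //; exact: measurable_int ipsi.
  - exact: measurable_int ipsi.
  exists N; split => // x /= hx; apply: contrapT => Nx; apply: hx => Bx.
  by rewrite ger0_norm// ltW// psi_gt0.
have [N' [mN' N'0 sN']] : ae_eq mu (fiber (B n)) (EFin \o psi) (cst 0).
  by apply/ae_eq_integral_abs => //; exact: measurable_int ipsi.
(* [psi] is positive off [N] and zero off [N'], so these two null sets cover the fiber. *)
apply/eqP; rewrite -measure_le0.
apply: (@le_trans _ _ (mu (N `|` N'))).
  apply: le_measure; rewrite ?inE//; first exact: measurableU.
  move=> x Bx; case: (pselect (N x)) => [|Nx]; [by left|right].
  apply: sN' => /= /(_ Bx) [] /eqP; apply/negP.
  by rewrite gt_eqF// psi_gt0.
by rewrite -[0](adde0 0) -{1}N0 -N'0; exact: measureU2.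
Qed.

(* The supporting line of phi at g (F x), evaluated at h x, is integrated over
   sets where its slope is bounded; its linear part has mean zero. *)
Lemma conditional_jensen : \int[Q]_(u in X) phi (g u) <= \int[mu]_x phi (h x).
Proof.
pose s u := divergence_slope phi a b (g u).
have ms : measurable_fun [set u | a < (g u)%:E < b] s.
  have mslope := measurable_divergence_slope phi_ge0 phi_convex phi_dom.
  apply: (measurable_comp _ _ mslope); last exact: measurable_funTS.
    apply: is_interval_measurable => x y /= /andP[ax xb] /andP[ay yb] z /andP[xz zy].
    by rewrite (lt_le_trans ax) ?lee_fin//= (le_lt_trans _ yb) ?lee_fin.
  by move=> _ [u /= gu <-].
(* The bound on the slope makes the linear part integrable; the bound on [phi (g u)] does the same
   for the constant part, so that the mean-zero linear part can be added without changing the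
   integral. *)
pose B m := @open01_exhaustion R m `&` ([set u | a < (g u)%:E < b] `&`
  [set u | (`|s u| <= m%:R)%R]) `&` [set u | phi (g u) <= m%:R%:E].
have mphig A : measurable_fun A (fun u => phi (g u)).
  by apply: measurable_funTS; exact: (measurableT_comp mphi mg).
have mB m : measurable (B m).
  apply: measurableI; first apply: measurableI => //.
    apply: measurable_fun_le => //; exact: measurableT_comp.
  rewrite -[X in measurable X]setTI; apply: emeasurable_fun_le => //; exact: mphig.
have Bdom m u : B m u -> a < (g u)%:E < b by move=> [[_ []]].
have key m : \int[Q]_(u in B m) phi (g u) <= \int[mu]_x phi (h x).
  have mfB : measurable (fiber (B m) : set (measurableTypeR R)).
    exact: measurable_fiber.
  rewrite (ge0_integral_quantile QF)//.
  apply: (@le_trans _ _ (\int[mu]_(x in fiber (B m)) phi (h x))); last first.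
    by apply: ge0_subset_integral => //; exact: mphih.
  have msB : measurable_fun (B m) s.
    by apply: measurable_funS ms => // u /Bdom.
  have ish : mu.-integrable (fiber (B m)) (fun x => (s (F x) * h x)%:E).
    apply: (bounded_integrable (n := m) (M := m%:R)) => //.
    - by move=> u [[]].
    - by move=> u [[_ []]].
  have [isg sgE] := hg (mB m) msB ish.
  have phigE x : fiber (B m) x -> phi (g (F x)) = (fine (phi (g (F x))))%:E.
    by move=> [/Bdom]; rewrite -dom => gx _; rewrite fineK// ge0_fin_numE.
  have mphigF : measurable_fun (fiber (B m) : set (measurableTypeR R))
      (fun x => phi (g (F x))).
    exact: (measurable_comp_cumulative (F := F) (mB m) (mphig _)).
  have ip : mu.-integrable (fiber (B m)) (fun x => phi (g (F x))).
    apply/integrableP; split => //.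
    apply: (@le_lt_trans _ _ (\int[mu]_(x in fiber (B m)) (cst m%:R%:E) x)).
      apply: ge0_le_integral => //.
      - exact: measurableT_comp.
      - by move=> x [[_ /=]]; rewrite gee0_abs.
    rewrite integral_cst// lte_mul_pinfty// ?lee_fin//.
    apply: le_lt_trans (lebesgue_preimage_open01_exhaustion F m).
    apply: le_measure; rewrite ?inE//; first exact: measurable_preimage_cumulative.
    by move=> x [[[]]].
  have isD : mu.-integrable (fiber (B m))
      (fun x => (s (F x) * h x)%:E - (s (F x) * g (F x))%:E).
    exact: integrableB.
  have -> : \int[mu]_(x in fiber (B m)) phi (g (F x)) =
      \int[mu]_(x in fiber (B m)) (phi (g (F x)) +
        ((s (F x) * h x)%:E - (s (F x) * g (F x))%:E)).
    rewrite integralD// integralB// sgE subee ?adde0//.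
    exact: integrable_fin_num.
  apply: le_integral => //.
  - exact: integrableD.
  - apply/integrableP; split; first exact: mphih.
    under eq_integral do rewrite gee0_abs//.
    apply: le_lt_trans phih; apply: ge0_subset_integral => //; exact: mphih.
  - move=> x /set_mem Bx; rewrite phigE// -EFinB -EFinD -mulrBr.
    have gx : a < (g (F x))%:E < b by case: Bx => /Bdom.
    exact: (divergence_slopeP phi_ge0 phi_convex phi_dom (h x) gx).
have ndB : nondecreasing_seq B.
  move=> m n mn; rewrite subsetEset => u [[Iu [gu su]] pu].
  have mnR : (m%:R <= n%:R :> R)%R by rewrite ler_nat.
  split; last by apply: le_trans pu _; rewrite lee_fin.
  split; last by split => //; apply: le_trans su _.
  move: Iu; have := @nondecreasing_open01_exhaustion R _ _ mn.
  by rewrite subsetEset; apply.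
have UB : \bigcup_m B m = X `&` [set u | a < (g u)%:E < b].
  apply/seteqP; split => [u [m _ Bu]|u [Xu gu]].
    split; last exact: Bdom Bu.
    by rewrite -bigcup_open01_exhaustion; case: Bu => -[Iu _] _; exists m.
  move: Xu; rewrite -bigcup_open01_exhaustion => -[n _ Iu].
  have pfin : phi (g u) = (fine (phi (g u)))%:E.
    by rewrite fineK// ge0_fin_numE// dom.
  pose m := maxn n (maxn (Num.truncn `|s u|).+1 (Num.truncn (fine (phi (g u)))).+1).
  exists m => //; split; last first.
    rewrite /= pfin lee_fin (le_trans (ltW (truncnS_gt _)))// ler_nat.
    by rewrite !leq_max leqnn !orbT.
  split.
    have : (n <= m)%N by rewrite leq_max leqnn.
    by move=> /(@nondecreasing_open01_exhaustion R); rewrite subsetEset; apply.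
  split => //=; rewrite (le_trans (ltW (truncnS_gt _)))// ler_nat.
  by rewrite !leq_max leqnn !orbT.
(* The union of the [B m] misses only the points of [X] where [g] leaves the domain, a null set by
   [conditional_mean_dom]. *)
have -> : \int[Q]_(u in X) phi (g u) = \int[Q]_(u in \bigcup_m B m) phi (g u).
  have mXd : measurable (X `&` [set u | a < (g u)%:E < b]) by exact: measurableI.
  have mXN : measurable (X `&` ~` [set u | a < (g u)%:E < b]).
    by apply: measurableI => //; exact: measurableC.
  rewrite UB (ge0_negligible_integral mXN)//.
  - congr integral; apply/seteqP; split => u /= [Xu gu]; split => //.
      by apply: contrapT => ngu; apply: gu.
    by move=> [_].
  - have [N [mN N0 sN]] := conditional_mean_dom.
    apply: (subset_measure0 mXN mN) => //.
    by move=> u [Xu gu]; apply: sN; split => //=; exact/negP.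
have cvgB : \int[Q]_(u in B m) phi (g u) @[m --> \oo] -->
    \int[Q]_(u in \bigcup_m B m) phi (g u).
  exact: ge0_nondecreasing_set_cvg_integral.
rewrite -(cvg_lim _ cvgB)//; apply: lime_le.
  by apply/cvg_ex; eexists; exact: cvgB.
by apply: nearW => m; exact: key.
Qed.

End conditional_jensen.

Section function_to_quantile.
Local Open Scope ereal_scope.
Variables (R : realType) (phi : R -> \bar R) (a b : \bar R).
Hypothesis phi_ge0 : forall x, 0 <= phi x.
Hypothesis phi_convex : strictly_convex phi.
Hypothesis phi1 : phi 1%R = 0.
Hypothesis phi_dom : [set x | phi x < +oo] = [set x | a < x%:E < b].
Hypothesis ab1 : a < 1 < b.
Variables (F : cumulativeBounded (0%R : R) (1%R : R)).
Variable Q : {sigma_finite_measure set (measurableTypeR R) -> \bar R}.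
Hypothesis QF : quantile_measure F Q.
Variables (l : nat) (i : 'I_l -> nat) (c : 'cV[R]_l).
Hypothesis i_ge2 : forall j, (2 <= i j)%N.
Local Notation mu := (@lebesgue_measure R).
Local Notation X := (open01 R).
Local Notation D := (F @^-1` (open01 R)).
Local Notation fiber A := (F @^-1` A `&` (F @^-1` (open01 R))).

Let mX : measurable X. Proof. exact: measurable_open01. Qed.
Let mD : measurable (D : set (measurableTypeR R)).
Proof. exact: measurable_preimage_cumulative. Qed.
Let mF := measurable_cumulative F.
Let mI n : measurable (@open01_exhaustion R n).
Proof. exact: measurable_open01_exhaustion. Qed.

(** The two parts of [h] are conditioned separately and subtracted. The conclusion is quantified
    over all versions [g] because [density] picks an unspecified one. *)
Lemma conditional_signed_measure (h : R -> R) :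
  measurable_fun [set: measurableTypeR R] h ->
  \int[mu]_x phi (h x) < +oo ->
  exists G, [/\ sigma_finite_signed_measure_on X G, G `<< Q &
    forall g, is_density G Q g -> forall A (k : measurableTypeR R -> R),
      measurable A -> measurable_fun A k ->
      mu.-integrable (fiber A) (fun x => (k (F x) * h x)%:E) ->
      [/\ signed_integrable G A k,
        signed_integral G A k = fine (\int[mu]_(x in fiber A) (k (F x) * h x)%:E),
        Q.-integrable A (fun u => (k u * g u)%:E) &
        \int[Q]_(u in A) (k u * g u)%:E =
        \int[mu]_(x in fiber A) (k (F x) * h x)%:E]].
Proof.
move=> mh phih.
have mhp : measurable_fun [set: measurableTypeR R] h^\+%R.
  exact: measurable_funrpos.
have mhn : measurable_fun [set: measurableTypeR R] h^\-%R.
  exact: measurable_funrneg.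
have ihn := divergence_funrneg_integrable phi_ge0 phi_convex phi1 phi_dom ab1 mh phih.
have mfI n : measurable (fiber (@open01_exhaustion R n) : set (measurableTypeR R)).
  exact: measurable_fiber.
have ihI n : mu.-integrable (fiber (@open01_exhaustion R n)) (EFin \o h).
  apply: (divergence_locally_integrable phi_ge0 phi_convex phi1 phi_dom ab1) => //.
  by rewrite fiber_open01_exhaustion; exact: lebesgue_preimage_open01_exhaustion.
have hplty n : \int[mu]_(x in fiber (@open01_exhaustion R n)) (h^\+ x)%:E < +oo.
  have := integral_funepos_lt_pinfty (mfI n) (ihI n).
  by rewrite funerpos.
have hnlty n : \int[mu]_(x in fiber (@open01_exhaustion R n)) (h^\- x)%:E < +oo.
  have := integral_funeneg_lt_pinfty (mfI n) (ihI n).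
  by rewrite funerneg.
have [g1 [mg1 g10 g1E]] := ge0_conditional_density QF mhp (funrpos_ge0 h) hplty.
have [g2 [mg2 g20 g2E]] := ge0_conditional_density QF mhn (funrneg_ge0 h) hnlty.
pose g := (g1 \- g2)%R.
have mg : measurable_fun setT g by exact: measurable_funB.
pose G A := \int[Q]_(u in A) (g u)%:E.
have gG : is_density G Q g by split.
have realE A (k : measurableTypeR R -> R) : measurable A -> measurable_fun A k ->
    mu.-integrable (fiber A) (fun x => (k (F x) * h x)%:E) ->
    Q.-integrable A (fun u => (k u * g u)%:E) /\
    \int[Q]_(u in A) (k u * g u)%:E =
    \int[mu]_(x in fiber A) (k (F x) * h x)%:E.
  move=> mA mk ikh.
  have mfA : measurable (fiber A : set (measurableTypeR R)) by exact: measurable_fiber.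
  have mkF : measurable_fun (fiber A : set (measurableTypeR R)) (fun x => k (F x)).
    apply: (measurable_comp mA _ mk); first by move=> _ [x [? _] <-].
    exact: measurable_funTS.
  have part (w : R -> R) : measurable_fun [set: measurableTypeR R] w ->
      (forall x, `|w x| <= `|h x|)%R ->
      mu.-integrable (fiber A) (fun x => (k (F x) * w x)%:E).
    move=> mw wh; apply: le_integrable ikh => //.
      by apply/measurable_EFinP/measurable_funM => //; exact: measurable_funTS.
    by move=> x _ /=; rewrite lee_fin !normrM ler_wpM2l.
  have ikp : mu.-integrable (fiber A) (fun x => (k (F x) * h^\+ x)%:E).
    apply: part => // x; rewrite ger0_norm ?funrpos_ge0//.
    by rewrite /funrpos ge_max ler_norm normr_ge0.
  have ikn : mu.-integrable (fiber A) (fun x => (k (F x) * h^\- x)%:E).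
    apply: part => // x; rewrite ger0_norm ?funrneg_ge0//.
    by rewrite /funrneg ge_max -normrN ler_norm normr_ge0.
  have [i1 e1] :=
    conditional_density_Rintegral mhp (funrpos_ge0 h) mg1 g10 g1E mA mk ikp.
  have [i2 e2] :=
    conditional_density_Rintegral mhn (funrneg_ge0 h) mg2 g20 g2E mA mk ikn.
  have gE : (fun u => (k u * g u)%:E) =
      (fun u => (k u * g1 u)%:E) \- (fun u => (k u * g2 u)%:E).
    by apply/funext => u; rewrite /g/= -EFinB -mulrBr.
  have hE : (fun x => (k (F x) * h x)%:E) =
      (fun x => (k (F x) * h^\+ x)%:E) \- (fun x => (k (F x) * h^\- x)%:E).
    apply/funext => x; rewrite /= -EFinB -mulrBr.
    by rewrite -[in LHS](funrposBneg h).
  rewrite gE hE; split; first exact: integrableB.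
  by rewrite !integralB// e1 e2.
(* [g1] and [g2] may be positive at the same point, so [g2] only dominates [g^-]; its integral is
   that of [h^-] over [D], which is finite. *)
have ign2 : Q.-integrable setT (EFin \o g^\-%R).
  apply/integrableP; split; first by apply/measurable_EFinP; exact: measurable_funrneg.
  apply: (@le_lt_trans _ _ (\int[Q]_u (cst 1 u * (g2 u)%:E))).
    apply: ge0_le_integral => //.
    - apply: measurableT_comp => //; apply/measurable_EFinP.
      exact: measurable_funrneg.
    - by under eq_fun do rewrite mul1e; exact/measurable_EFinP.
    - move=> u _; rewrite mul1e /= lee_fin ger0_norm ?funrneg_ge0//.
      by rewrite /funrneg /g/= ge_max g20 andbT opprB lerBlDr lerDl.
  rewrite g2E//.
  have /integrableP[_] := integrableS measurableT
    (measurable_fiber F measurableT) (@subsetT _ _) ihn.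
  apply: le_lt_trans; rewrite le_eqVlt; apply/orP; left; apply/eqP.
  by apply: eq_integral => x _; rewrite mul1e /= ger0_norm// funrneg_ge0.
exists G; split.
- split; first exact: signed_measure_of_density.
    move=> A mA AX; apply: null_set_integral => //.
      by apply/measurable_EFinP; exact: measurable_funTS.
    apply: (subset_measure0 (B := ~` X)) => //; first exact: measurableC.
    by case: QF.
  exists (@open01_exhaustion R); first by rewrite bigcup_open01_exhaustion.
  move=> n; split => //; apply: integrable_fin_num => //.
  have ih1 : mu.-integrable (fiber (@open01_exhaustion R n))
      (fun x => ((cst 1%R : measurableTypeR R -> R) (F x) * h x)%:E).
    by apply: eq_integrable (ihI n) => // x _; rewrite /= mul1r.
  have [ig _] := realE _ (cst 1%R) (mI n) (@measurable_cst _ _ _ _ _ _) ih1.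
  by apply: eq_integrable ig => // u _; rewrite /= mul1r.
- apply/null_content_dominatesP => A mA QA; apply: null_set_integral => //.
  by apply/measurable_EFinP; exact: measurable_funTS.
(* Integrability and integral pass from the version [g] to [g'] through [signed_integrable] and
   [signed_integral], which depend on [G] alone. *)
- move=> g' g'G A k mA mk ikh.
  have [ikg kgE] := realE _ _ mA mk ikh.
  have sik : signed_integrable G A k by apply/(signed_integrable_density gG).
  have [_ ikg'] := proj1 (signed_integrable_density g'G _ mA) sik.
  have e1 := signed_integral_density gG mA mk ikg.
  have e2 := signed_integral_density g'G mA mk ikg'.
  split => //.
    by rewrite e1 /Rintegral kgE.
  rewrite -kgE -[LHS]fineK ?(integrable_fin_num mA ikg')//.
  rewrite -[RHS]fineK ?(integrable_fin_num mA ikg)//.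
  by congr EFin; rewrite -[LHS]/(Rintegral Q A _) -e2 e1.
Qed.

Lemma function_to_quantile T : L''_class i F c T ->
  \int[completed_lebesgue_measure]_x phi (derive1 T x) < +oo ->
  exists2 G, L_class i Q c G &
    \int[Q]_(u in X) phi (density G Q u) <=
    \int[completed_lebesgue_measure]_x phi (derive1 T x).
Proof.
move=> [Tae iKT cT].
have [h mh hT] := measurable_derive1_representative T.
(* The parameter [P] covers both uses of the Borel representative: in the divergence and in the
   constraints. *)
have hTae (P : R -> R -> \bar R) :
    {ae @completed_lebesgue_measure R, forall x, P x (h x) = P x (derive1 T x)}.
  case: Tae => N [mN N0 sN]; exists N; split => // x /= hx.
  by apply: sN => /= Tx; apply: hx; rewrite hT.
have mphi := measurable_divergence phi_ge0 phi_convex phi_dom.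
have mphih : measurable_fun [set: measurableTypeR R] (fun x => phi (h x)).
  exact: (measurableT_comp mphi mh).
have phiE := ae_integral_completed mphih (hTae (fun _ y => phi y)).
rewrite phiE => phih.
have mKX j : measurable_fun X (@Kfun R (i j)) by exact: measurable_Kfun.
have mKh j : measurable_fun (D : set (measurableTypeR R))
    (fun x => (Kfun (i j) (F x) * h x)%:E).
  apply/measurable_EFinP/measurable_funM; last exact: measurable_funTS.
  apply: (measurable_comp mX _ (mKX j)); first by move=> _ [x ? <-].
  exact: measurable_funTS.
have KhE j : (fun x => (Kfun (i j) (F x) * h x)%:E) =
    (fun x => (Kfun (i j) (F x) * h x)%:E) \_ D.
  apply/funext => x; rewrite patchE; case: ifPn => //.
  by rewrite notin_setE => /Kfun_cumulative_eq0 ->//; rewrite mul0r.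
have mKhT j : measurable_fun [set: measurableTypeR R]
    (fun x => (Kfun (i j) (F x) * h x)%:E).
  rewrite KhE; have h1 := proj1 (@measurable_restrictT _ _ (measurableTypeR R) _ D
    (fun x => (Kfun (i j) (F x) * h x)%:E) mD).
  have h2 := h1 (mKh j); exact: h2.
have KTh j := hTae (fun x y => (Kfun (i j) (F x) * y)%:E).
have iKh j : mu.-integrable (fiber X) (fun x => (Kfun (i j) (F x) * h x)%:E).
  rewrite setIid integrable_mkcond// -KhE.
  exact/(ae_integrable_completed (mKhT j) (KTh j)).
have [G [sG GQ GE]] := conditional_signed_measure mh phih.
have [g0 g0G] := signed_radon_nikodym sG GQ.
have gG : is_density G Q (density G Q).
  exact: (@xgetPex _ (cst 0%R) [set g | is_density G Q g] (ex_intro _ g0 g0G)).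
have mg : measurable_fun setT (density G Q) by case: gG.
exists G.
  split => //.
  - by move=> j; have [] := GE _ gG _ _ mX (mKX j) (iKh j).
  - rewrite -cT; apply/colP => j; rewrite !mxE.
    have [_ -> _ _] := GE _ gG _ _ mX (mKX j) (iKh j).
    rewrite /Rintegral (ae_integral_completed (mKhT j) (KTh j)) setIid.
    by rewrite integral_mkcond -KhE.
apply: (conditional_jensen phi_ge0 phi_convex phi1 phi_dom ab1 QF) => // A k mA mk ikh.
have [_ _ ikg kgE] := GE _ gG _ _ mA mk ikh.
have mkg : measurable_fun A (fun u => (k u * density G Q u)%:E).
  exact: measurable_int ikg.
split.
  exact/(integrable_quantile QF mA mkg).
by rewrite -kgE (integral_quantile QF mA mkg).
Qed.

End function_to_quantile.

Theorem proposition6p2 (R : realType)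
  (phi : R -> \bar R) (a b : \bar R)
  (phi_ge0 : forall x, (0 <= phi x)%E)
  (phi_convex : strictly_convex phi)
  (phi1 : phi 1 = 0%E)
  (phi_dom : [set x | (phi x < +oo)%E] = [set x | (a < x%:E < b)%E])
  (ab1 : (a < 1 < b)%E)
  (l : nat) (l_gt0 : (0 < l)%N) (i : 'I_l -> nat)
  (i_ge2 : forall j, (2 <= i j)%N)
  (i_incr : forall j k : 'I_l, (j < k)%N -> (i j < i k)%N)
  (d : nat) (Theta : set 'rV[R]_d) (f : Theta -> 'cV[R]_l) (theta : Theta)
  (F : cumulativeBounded (0 : R) (1 : R))
  (F_expectation :
     (lebesgue_stieltjes_measure F).-integrable setT (fun x : R => x%:E))
  (Q : {sigma_finite_measure set (measurableTypeR R) -> \bar R})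
  (Q_quantile : quantile_measure F Q)
  (hT : exists2 T : R -> R, L''_class i F (f theta) T &
     {ae completed_lebesgue_measure, forall x : R, (a < (derive1 T x)%:E < b)%E})
  (hG : exists2 G, L_class i Q (f theta) G &
     {ae Q, forall u : R, (a < (density G Q u)%:E < b)%E}) :
  ereal_inf [set (\int[Q]_(u in open01 R) phi (density G Q u))%E
              | G in L_class i Q (f theta)] =
  ereal_inf [set (\int[completed_lebesgue_measure]_x phi (derive1 T x))%E
              | T in L''_class i F (f theta)].
Proof.
apply/eqP; rewrite eq_le; apply/andP; split.
- apply: le_ereal_inf_tmp => _ [T LT <-].
  have [->|] := eqVneq (\int[completed_lebesgue_measure]_x phi (derive1 T x))%E +oo%E.
    exact: leey.
  rewrite -ltey => phiT.
  have [G LG GT] := function_to_quantile phi_ge0 phi_convex phi1 phi_dom ab1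
    Q_quantile i_ge2 LT phiT.
  by apply: le_trans GT; apply: ereal_inf_lbound; exists G.
- apply: le_ereal_inf_tmp => _ [G LG <-].
  have [->|] := eqVneq (\int[Q]_(u in open01 R) phi (density G Q u))%E +oo%E.
    exact: leey.
  rewrite -ltey => phiG.
  have [T LT TG] := quantile_to_function phi_ge0 phi_convex phi1 phi_dom ab1
    Q_quantile i_ge2 LG phiG.
  by rewrite -TG; apply: ereal_inf_lbound; exists T.
Qed.
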